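(* Let $k$ be a field, and for each integer $n\ge1$ let $X_n=\{x_0,\dots,x_n\}$ and $Y_n=\{y_0,\dots,y_n\}$ (initial segments of fixed infinite sequences $x_0,x_1,\dots$ and $y_0,y_1,\dots$). For each $n\geq 1$ let $R_n$ be a local $k$-subalgebra of $k\langle\langle X_n\rangle\rangle$ containing $k\langle X_n\rangle$ and invariant under $\delta_0,\dots,\delta_n$, and assume $R_1\subset R_2\subset\cdots$. Let $S_n=R_n\langle Y_n;\tau,\delta\rangle$, and let $S_\infty=\bigcup_{n=1}^\infty S_n$ with respect to the natural inclusions $S_n\subset S_{n+1}$. Then the ring $S_\infty$ is simple, regular, and purely infinite, and $K_0(S_\infty)$ is an infinite cyclic group, with generator $[S_\infty]$.
   Context: All rings are unital; ''regular'' means von Neumann regular. $k\langle X_n\rangle$ is the free $k$-algebra and $k\langle\langle X_n\rangle\rangle$ the algebra of noncommutative formal power series $\sum_{w\in X_n^*}\lambda_w w$ ($\lambda_w\in k$), where $X_n^*$ is the free monoid on $X_n$; $k\langle\langle X_n\rangle\rangle\subset k\langle\langle X_{n+1}\rangle\rangle$ in the natural way. $\tau$ takes a series to its constant term, and the $k$-linear maps $\delta_i$ are given by $\delta_i\bigl(\sum_w\lambda_w w\bigr)=\sum_w\lambda_{wx_i}w$; they satisfy $\delta_i(rs)=\delta_i(r)\tau(s)+r\delta_i(s)$. $R_n\langle Y_n;\tau,\delta\rangle$ is the ring containing $R_n$ as a subring and the free monoid $Y_n^*$ as a multiplicative submonoid, which is free as a right $R_n$-module (under ring multiplication) with basis $Y_n^*$,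 and in which $ry_i=y_i\tau(r)+\delta_i(r)$ for all $i\in\{0,\dots,n\}$ and $r\in R_n$. The natural inclusion $S_n\subset S_{n+1}$ extends $R_n\subset R_{n+1}$ and sends $y_i$ to $y_i$. An idempotent $e$ in a ring $A$ is infinite if $e=g+h$ with $g,h$ orthogonal idempotents, $h\neq0$ and $eA\cong gA$; a simple ring is purely infinite if each of its nonzero right ideals contains an infinite idempotent. *)

(* Defs.v *)
From HB Require Import structures.
From mathcomp Require Import all_boot all_order all_algebra.
From mathcomp Require Import finmap.
From mathcomp Require Import monalg.
From mathcomp Require Import boolp classical_sets.

Set Implicit Arguments.
Unset Strict Implicit.
Unset Printing Implicit Defensive.

Import GRing.Theory.
Local Open Scope ring_scope.
Local Open Scope quotient_scope.

(* Series in the letters x_0, x_1, ...; the word x_{i_1} ... x_{i_m} is the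
   list [:: i_1; ...; i_m].  The algebra k<<X_n>> is the subset [series_in n]
   of the series supported on the words in x_0, ..., x_n, so that the
   inclusions k<<X_n>> < k<<X_(n+1)>> are inclusions of subsets. *)
Record ncser (k : fieldType) := NCSer { coef : seq nat -> k }.

HB.instance Definition _ (k : fieldType) := [isNew for @coef k].
HB.instance Definition _ (k : fieldType) := [Choice of ncser k by <:].

Section Series.
Variable k : fieldType.
Implicit Types (f g h : ncser k) (w : seq nat) (c : k).

Lemma ncserP f g : (forall w, coef f w = coef g w) <-> f = g.
Proof.
by split=> [|-> //]; case: f g => [f] [g] /= fg; congr NCSer; apply/funext.
Qed.

Definition ser_add f g := NCSer (fun w => coef f w + coef g w).
Definition ser_opp f := NCSer (fun w => - coef f w).
Definition ser_const c := NCSer (fun w => c *+ (w == [::])).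
Definition ser_scale c f := NCSer (fun w => c * coef f w).
Definition ser_mul f g := NCSer (fun w =>
  \sum_(i < (size w).+1) coef f (take i w) * coef g (drop i w)).

Fact ser_addA : associative ser_add.
Proof. by move=> f g h; apply/ncserP => w /=; rewrite addrA. Qed.
Fact ser_addC : commutative ser_add.
Proof. by move=> f g; apply/ncserP => w /=; rewrite addrC. Qed.
Fact ser_add0 : left_id (ser_const 0) ser_add.
Proof. by move=> f; apply/ncserP => w /=; rewrite mul0rn add0r. Qed.
Fact ser_addN : left_inverse (ser_const 0) ser_opp ser_add.
Proof. by move=> f; apply/ncserP => w /=; rewrite mul0rn addNr. Qed.

HB.instance Definition _ := GRing.isZmodule.Build (ncser k)
  ser_addA ser_addC ser_add0 ser_addN.

Lemma coefD f g w : coef (f + g) w = coef f w + coef g w. Proof. by []. Qed.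
Lemma coefN f w : coef (- f) w = - coef f w. Proof. by []. Qed.
Lemma coef0 w : coef (0 : ncser k) w = 0. Proof. exact: mul0rn. Qed.

(* Left derivative, only used to prove associativity. *)
Let lder a f := NCSer (fun w => coef f (a :: w)).

Let ser_mul_nil f g : coef (ser_mul f g) [::] = coef f [::] * coef g [::].
Proof. by rewrite /= big_ord1. Qed.

Let ser_mul_cons f g a w : coef (ser_mul f g) (a :: w) =
  coef f [::] * coef g (a :: w) + coef (ser_mul (lder a f) g) w.
Proof. by rewrite /= big_ord_recl. Qed.

Fact ser_mulDl : left_distributive ser_mul +%R.
Proof.
move=> f g h; apply/ncserP => w /=; rewrite -big_split /=.
by apply: eq_bigr => i _; rewrite mulrDl.
Qed.

Fact ser_mulDr : right_distributive ser_mul +%R.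
Proof.
move=> f g h; apply/ncserP => w /=; rewrite -big_split /=.
by apply: eq_bigr => i _; rewrite mulrDr.
Qed.

Let ser_scale_mull c f g : ser_mul (ser_scale c f) g = ser_scale c (ser_mul f g).
Proof.
by apply/ncserP => w /=; rewrite mulr_sumr; apply: eq_bigr => i _; rewrite mulrA.
Qed.

Fact ser_mulA : associative ser_mul.
Proof.
move=> f g h; apply/ncserP => w; elim: w f g h => [|a w IH] f g h.
  by rewrite !ser_mul_nil mulrA.
rewrite [LHS]ser_mul_cons [RHS]ser_mul_cons IH ser_mul_nil ser_mul_cons mulrDr.
have -> : lder a (ser_mul f g) =
    ser_scale (coef f [::]) (lder a g) + ser_mul (lder a f) g.
  by apply/ncserP => v; rewrite coefD -[RHS]ser_mul_cons.
by rewrite ser_mulDl coefD ser_scale_mull mulrA addrA.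
Qed.

Let ser_const_mul c f : ser_mul (ser_const c) f = ser_scale c f.
Proof.
apply/ncserP => w /=; rewrite big_ord_recl /= take0 drop0 mulr1n.
rewrite big1 ?addr0 // => i _; case: w i => [|a w] i; first by case: i.
by rewrite /= mulr0n mul0r.
Qed.

Fact ser_mul1 : left_id (ser_const 1) ser_mul.
Proof. by move=> f; rewrite ser_const_mul; apply/ncserP => w /=; rewrite mul1r. Qed.

Fact ser_mulr1 : right_id (ser_const 1) ser_mul.
Proof.
move=> f; apply/ncserP => w /=; rewrite big_ord_recr /= take_size drop_size.
rewrite mulr1 big1 ?add0r // => i _; rewrite -size_eq0 size_drop.
by rewrite subn_eq0 leqNgt ltn_ord mulr0.
Qed.

Fact ser_1neq0 : ser_const 1 != 0.
Proof.
by apply/eqP => /ncserP/(_ [::]) /= /eqP; rewrite oner_eq0.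
Qed.

HB.instance Definition _ := GRing.Zmodule_isNzRing.Build (ncser k)
  ser_mulA ser_mul1 ser_mulr1 ser_mulDl ser_mulDr ser_1neq0.

Fact ser_scaleA c d f : ser_scale c (ser_scale d f) = ser_scale (c * d) f.
Proof. by apply/ncserP => w /=; rewrite mulrA. Qed.
Fact ser_scale1 : left_id 1 ser_scale.
Proof. by move=> f; apply/ncserP => w /=; rewrite mul1r. Qed.
Fact ser_scaleDr : right_distributive ser_scale +%R.
Proof. by move=> c f g; apply/ncserP => w /=; rewrite mulrDr. Qed.
Fact ser_scaleDl f : {morph ser_scale^~ f : c d / c + d}.
Proof. by move=> c d; apply/ncserP => w /=; rewrite mulrDl. Qed.

HB.instance Definition _ := GRing.Zmodule_isLmodule.Build k (ncser k)
  ser_scaleA ser_scale1 ser_scaleDr ser_scaleDl.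

Fact ser_scaleAl c f g : c *: (f * g) = c *: f * g.
Proof. by apply/esym/ser_scale_mull. Qed.

HB.instance Definition _ := GRing.Lmodule_isLalgebra.Build k (ncser k) ser_scaleAl.

Fact ser_scaleAr c f g : c *: (f * g) = f * (c *: g).
Proof.
apply/ncserP => w /=; rewrite mulr_sumr; apply: eq_bigr => i _.
by rewrite mulrCA.
Qed.

HB.instance Definition _ := GRing.Lalgebra_isAlgebra.Build k (ncser k) ser_scaleAr.

Definition const_term f : k := coef f [::].

Definition delta i f : ncser k := NCSer (fun w => coef f (rcons w i)).

Definition series_in n : {pred ncser k} :=
  fun f => `[< forall w, coef f w != 0 -> all (fun i => (i <= n)%N) w >].

Definition freealg_in n : {pred ncser k} :=
  fun f => (f \in series_in n) &&
    `[< exists s : seq (seq nat), forall w, coef f w != 0 -> w \in s >].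

Lemma coefM f g w : coef (f * g) w =
  \sum_(i < (size w).+1) coef f (take i w) * coef g (drop i w).
Proof. by []. Qed.

Lemma coefA c w : coef (c%:A : ncser k) w = c *+ (w == [::]).
Proof. by rewrite /= mulrnAr mulr1. Qed.

Lemma const_termM f g : const_term (f * g) = const_term f * const_term g.
Proof. exact: ser_mul_nil. Qed.

Lemma const_termD f g : const_term (f + g) = const_term f + const_term g.
Proof. by []. Qed.

Lemma deltaD i f g : delta i (f + g) = delta i f + delta i g.
Proof. exact/ncserP. Qed.

Lemma deltaM i f g :
  delta i (f * g) = delta i f * (const_term g)%:A + f * delta i g.
Proof.
have constE h c : h * c%:A = c *: h by rewrite -scalerAr mulr1.
rewrite constE; apply/ncserP => w; rewrite coefD [LHS]coefM size_rcons.
rewrite big_ord_recr addrC /=; congr (_ + _); last first.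
  by rewrite drop_oversize ?take_oversize ?size_rcons // mulrC.
apply: eq_bigr => j _; have le_jw := leq_ord j.
rewrite -cats1 takel_cat // drop_cat ltn_neqAle le_jw andbT.
case: eqVneq => /= [->|_]; last by rewrite cats1.
by rewrite subnn drop0 drop_size.
Qed.

Lemma deltaC i c : delta i c%:A = 0.
Proof. by apply/ncserP => w; rewrite coef0 /=; case: w => [|a w]; rewrite mulr0. Qed.

Lemma delta0 i : delta i 0 = 0.
Proof. by apply/ncserP => w; rewrite [RHS]coef0; apply: coef0. Qed.

End Series.

Arguments const_term : simpl never.
Arguments delta : simpl never.

(* The ring k<<X>><Y; tau, delta> on all the letters x_0, x_1, ... and
   y_0, y_1, ...: an element sum_u y_u r_u, where y_u is the product of the
   letters y_i along the word u, is the finitely supported function u |-> r_u.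
   Its defining properties are [sk_ofM], [sk_yM], [sk_basis], [sk_coef_sum] and
   [sk_of_y] below.  Each R_n<Y_n; tau, delta> is a subring of it, so that the
   natural inclusions between them are inclusions of subsets. *)
Definition skew (k : fieldType) := {malg (ncser k)[seq nat]}.

HB.instance Definition _ (k : fieldType) := GRing.Zmodule.on (skew k).

Section LinearExtension.
Variables (K : choiceType) (G W : zmodType).

Definition malg_ext (F : K -> G -> W) (a : {malg G[K]}) : W :=
  \sum_(u <- msupp a) F u a@_u.

Lemma malg_ext0 F : malg_ext F 0 = 0.
Proof. by rewrite /malg_ext msupp0 big_nil. Qed.

Lemma malg_additive_eq (F H : {malg G[K]} -> W) :
  {morph F : a b / a + b} -> {morph H : a b / a + b} ->
  (forall c u, F << c *g u >> = H << c *g u >>) -> F =1 H.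
Proof.
move=> FD HD FH a.
have F0 : F 0 = 0 by apply: (addrI (F 0)); rewrite -FD !addr0.
have H0 : H 0 = 0 by apply: (addrI (H 0)); rewrite -HD !addr0.
rewrite (monalgE a) (big_morph F FD F0) (big_morph H HD H0).
by apply: eq_bigr => u _; apply: FH.
Qed.

Variable F : K -> G -> W.
Hypothesis FD : forall u, {morph F u : a b / a + b}.

Let F0 u : F u 0 = 0.
Proof. by apply: (addrI (F u 0)); rewrite -FD !addr0. Qed.

Lemma malg_extw (d : {fset K}) a : (msupp a `<=` d)%fset ->
  malg_ext F a = \sum_(u <- d) F u a@_u.
Proof.
move=> sub; rewrite /malg_ext (big_fset_incl _ sub) //= => u _ /mcoeff_outdom ->.
exact: F0.
Qed.

Lemma malg_extD : {morph malg_ext F : a b / a + b}.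
Proof.
move=> a b; pose d := (msupp a `|` msupp b)%fset.
rewrite !(@malg_extw d) ?fsubsetUl ?fsubsetUr ?msuppD_le // -big_split /=.
by apply: eq_bigr => u _; rewrite mcoeffD FD.
Qed.

Lemma malg_extU c u : malg_ext F << c *g u >> = F u c.
Proof. by rewrite (malg_extw (@msuppU_le _ _ u c)) big_seq_fset1 mcoeffUU. Qed.

End LinearExtension.

Section Skew.
Variable k : fieldType.
Implicit Types (r s t : ncser k) (u v w : seq nat) (a b c d : skew k).

(* The product r y_v, forced by r y_i = y_i tau(r) + delta_i(r). *)
Fixpoint sk_lmulw r v : skew k :=
  if v is i :: v' then << (const_term r)%:A *g v >> + sk_lmulw (delta i r) v'
  else << r *g [::] >>.

(* y_u a, a r, r a and a b *)
Definition sk_ymul u a : skew k := malg_ext (fun v s => << s *g u ++ v >>) a.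
Definition sk_rmul r a : skew k := malg_ext (fun v s => << s * r *g v >>) a.
Definition sk_lmul r a : skew k := malg_ext (fun v s => sk_rmul s (sk_lmulw r v)) a.
Definition sk_mul a b : skew k := malg_ext (fun u r => sk_ymul u (sk_lmul r b)) a.

Let skext (F H : skew k -> skew k) :
  {morph F : a b / a + b} -> {morph H : a b / a + b} ->
  (forall r u, F << r *g u >> = H << r *g u >>) -> F =1 H.
Proof. exact: malg_additive_eq. Qed.

Let morphD_add (F H : skew k -> skew k) :
  {morph F : a b / a + b} -> {morph H : a b / a + b} ->
  {morph (fun a => F a + H a) : a b / a + b}.
Proof. by move=> FD HD a b; rewrite FD HD addrACA. Qed.

Let morphD_comp (F H : skew k -> skew k) :
  {morph F : a b / a + b} -> {morph H : a b / a + b} ->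
  {morph (fun a => F (H a)) : a b / a + b}.
Proof. by move=> FD HD a b; rewrite HD FD. Qed.

Let lmulwD v : {morph sk_lmulw^~ v : r s / r + s}.
Proof.
elim: v => [|i v IH] r s /=; first exact: monalgUD.
by rewrite deltaD IH const_termD scalerDl monalgUD addrACA.
Qed.

Let ymulD u : {morph sk_ymul u : a b / a + b}.
Proof. by apply: malg_extD => v r s; rewrite monalgUD. Qed.
Let ymulU u v r : sk_ymul u << r *g v >> = << r *g u ++ v >>.
Proof. by apply: malg_extU => w s t; rewrite monalgUD. Qed.

Let rmulD r : {morph sk_rmul r : a b / a + b}.
Proof. by apply: malg_extD => v s t; rewrite mulrDl monalgUD. Qed.
Let rmulU r v s : sk_rmul r << s *g v >> = << s * r *g v >>.
Proof. by apply: malg_extU => w t t'; rewrite mulrDl monalgUD. Qed.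
Let rmulDl a : {morph sk_rmul^~ a : r s / r + s}.
Proof.
move=> r s; move: a; apply: skext => [||t v]; [exact: rmulD| |].
  by apply: morphD_add; apply: rmulD.
by rewrite !rmulU mulrDr monalgUD.
Qed.

Let lmulD r : {morph sk_lmul r : a b / a + b}.
Proof. by apply: malg_extD => v s t; rewrite rmulDl. Qed.
Let lmulU r v s : sk_lmul r << s *g v >> = sk_rmul s (sk_lmulw r v).
Proof. by apply: malg_extU => w t t'; rewrite rmulDl. Qed.
Let lmulDl a : {morph sk_lmul^~ a : r s / r + s}.
Proof.
move=> r s; move: a; apply: skext => [||t v]; [exact: lmulD| |].
  by apply: morphD_add; apply: lmulD.
by rewrite !lmulU lmulwD rmulD.
Qed.

Let mulDl : left_distributive sk_mul +%R.
Proof. by move=> a b c; apply: malg_extD => v s t; rewrite lmulDl ymulD. Qed.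
Let mulU u r b : sk_mul << r *g u >> b = sk_ymul u (sk_lmul r b).
Proof. by apply: malg_extU => v s t; rewrite lmulDl ymulD. Qed.
Let mulD d : {morph sk_mul^~ d : a b / a + b}.
Proof. by move=> a b; apply: mulDl. Qed.
Let mulDr : right_distributive sk_mul +%R.
Proof.
move=> a b c; move: a; apply: skext => [||r u]; first exact: mulD.
  by apply: morphD_add; apply: mulD.
by rewrite !mulU lmulD ymulD.
Qed.

Let ymulA u v a : sk_ymul u (sk_ymul v a) = sk_ymul (u ++ v) a.
Proof.
move: a; apply: skext => [a b|a b|r w]; rewrite ?ymulD //.
by rewrite !ymulU catA.
Qed.

Let ymul_nil a : sk_ymul [::] a = a.
Proof. by move: a; apply: skext => [a b|a b|r w]; rewrite ?ymulD ?ymulU. Qed.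

Let rmulA r s a : sk_rmul r (sk_rmul s a) = sk_rmul (s * r) a.
Proof.
move: a; apply: skext => [a b|a b|t w]; rewrite ?rmulD //.
by rewrite !rmulU mulrA.
Qed.

Let lmul_rmul r s a : sk_lmul r (sk_rmul s a) = sk_rmul s (sk_lmul r a).
Proof.
move: a; apply: skext => [a b|a b|t w]; rewrite ?rmulD ?lmulD ?rmulD //.
by rewrite rmulU !lmulU rmulA.
Qed.

Let lmulw0 v : sk_lmulw 0 v = 0.
Proof. by apply: (addrI (sk_lmulw 0 v)); rewrite -lmulwD !addr0. Qed.

Let const_termC (x : k) : const_term (x%:A : ncser k) = x.
Proof. by rewrite /const_term coefA. Qed.

Let lmulwC x v : sk_lmulw x%:A v = << x%:A *g v >>.
Proof. by case: v => [//|i v] /=; rewrite deltaC lmulw0 addr0 const_termC. Qed.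

Let lmulwMC r x v : sk_lmulw (r * x%:A) v = sk_rmul x%:A (sk_lmulw r v).
Proof.
elim: v r => [|i v IH] r /=; first by rewrite rmulU.
rewrite deltaM deltaC mulr0 addr0 const_termC IH rmulD rmulU.
by rewrite const_termM const_termC mulr_algl scalerA mulrC.
Qed.

Let lmul_lmulw r s v : sk_lmul r (sk_lmulw s v) = sk_lmulw (r * s) v.
Proof.
elim: v s => [|i v IH] s /=; first by rewrite lmulU /= rmulU.
rewrite lmulD IH lmulU deltaM lmulwD addrA; congr (_ + _).
by rewrite -lmulwMC /= deltaM deltaC mulr0 addr0 const_termC !const_termM const_termC.
Qed.

Let lmulA r s a : sk_lmul r (sk_lmul s a) = sk_lmul (r * s) a.
Proof.
move: a; apply: skext => [a b|a b|t w]; rewrite ?lmulD //.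
by rewrite !lmulU lmul_rmul lmul_lmulw.
Qed.

Let lmulC_ymul x u a : sk_lmul x%:A (sk_ymul u a) = sk_ymul u (sk_lmul x%:A a).
Proof.
move: a; apply: skext => [a b|a b|t w]; rewrite ?lmulD ?ymulD ?lmulD ?ymulD //.
by rewrite ymulU !lmulU !lmulwC !rmulU ymulU.
Qed.

Let lmul_y r i a : sk_lmul r (sk_ymul [:: i] a) =
  sk_ymul [:: i] (sk_lmul (const_term r)%:A a) + sk_lmul (delta i r) a.
Proof.
move: a; apply: skext => [||t w].
- exact: (morphD_comp (lmulD _) (ymulD _)).
- exact: (morphD_add (morphD_comp (ymulD _) (lmulD _)) (lmulD _)).
by rewrite ymulU !lmulU /= rmulD lmulwC !rmulU ymulU.
Qed.

Let mul_lmulw r v a : sk_mul (sk_lmulw r v) a = sk_lmul r (sk_ymul v a).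
Proof.
elim: v r => [|i v IH] r /=; first by rewrite mulU !ymul_nil.
by rewrite mulDl mulU IH -[i :: v]cat1s -!ymulA lmul_y lmulC_ymul.
Qed.

Let mul_rmul r a b : sk_mul (sk_rmul r a) b = sk_mul a (sk_lmul r b).
Proof.
move: a; apply: skext => [||s u]; last by rewrite rmulU !mulU lmulA.
  exact: (morphD_comp (mulD _) (rmulD _)).
exact: mulD.
Qed.

Let mul_lmul r a b : sk_mul (sk_lmul r a) b = sk_lmul r (sk_mul a b).
Proof.
move: a; apply: skext => [a a'|a a'|s u]; rewrite ?lmulD ?mulDl ?lmulD //.
by rewrite lmulU mul_rmul mul_lmulw mulU.
Qed.

Let mul_ymul u a b : sk_mul (sk_ymul u a) b = sk_ymul u (sk_mul a b).
Proof.
move: a; apply: skext => [a a'|a a'|s v]; rewrite ?ymulD ?mulDl ?ymulD //.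
by rewrite ymulU !mulU ymulA.
Qed.

Fact sk_mulA : associative sk_mul.
Proof.
move=> a b c; move: a; apply: skext => [||r u].
- exact: mulD.
- exact: (morphD_comp (mulD _) (mulD _)).
by rewrite !mulU mul_ymul mul_lmul.
Qed.

Definition sk_of r : skew k := << r *g [::] >>.
Definition sk_y u : skew k := << 1 *g u >>.

Let lmul1 a : sk_lmul 1 a = a.
Proof.
move: a; apply: skext => [a b|a b|r u]; rewrite ?lmulD //.
by rewrite lmulU -[1]scale1r lmulwC rmulU scale1r mul1r.
Qed.

Fact sk_mul1 : left_id (sk_of 1) sk_mul.
Proof. by move=> a; rewrite mulU ymul_nil lmul1. Qed.

Let mulof a r : sk_mul a (sk_of r) = sk_rmul r a.
Proof.
move: a; apply: skext => [a b|a b|s u]; rewrite ?mulDl ?rmulD //.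
by rewrite mulU lmulU /= rmulU ymulU cats0 rmulU.
Qed.

Fact sk_mulr1 : right_id (sk_of 1) sk_mul.
Proof.
move=> a; rewrite mulof; move: a.
by apply: skext => [a b|a b|s u]; rewrite ?rmulD ?rmulU ?mulr1.
Qed.

Fact sk_1neq0 : sk_of 1 != 0.
Proof. by rewrite monalgU_eq0 oner_eq0. Qed.

HB.instance Definition _ := GRing.Zmodule_isNzRing.Build (skew k)
  sk_mulA sk_mul1 sk_mulr1 mulDl mulDr sk_1neq0.

Lemma sk_ofD : {morph sk_of : r s / r + s}. Proof. exact: monalgUD. Qed.
Lemma sk_of1 : sk_of 1 = 1. Proof. by []. Qed.
Lemma sk_ofM : {morph sk_of : r s / r * s}.
Proof. by move=> r s; rewrite [RHS]mulof rmulU. Qed.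
Lemma sk_of_inj : injective sk_of.
Proof. by move=> r s /malgP/(_ [::]); rewrite !mcoeffUU. Qed.

Lemma sk_y0 : sk_y [::] = 1. Proof. by []. Qed.
Lemma sk_yM u v : sk_y u * sk_y v = sk_y (u ++ v).
Proof. by rewrite [LHS]mulU lmul1 ymulU. Qed.

Lemma sk_yof u r : sk_y u * sk_of r = << r *g u >>.
Proof. by rewrite [LHS]mulof rmulU mul1r. Qed.

Lemma sk_basis a : a = \sum_(u <- msupp a) sk_y u * sk_of a@_u.
Proof. by rewrite {1}(monalgE a); apply: eq_bigr => u _; rewrite sk_yof. Qed.

Lemma sk_coef_sum (s : seq (seq nat)) (r : seq nat -> ncser k) v : uniq s ->
  (\sum_(u <- s) sk_y u * sk_of (r u))@_v = if v \in s then r v else 0.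
Proof.
move=> s_uniq; rewrite raddf_sum /=.
under eq_bigr => u _ do rewrite sk_yof mcoeffU mulrb.
case: ifP => [vs|/negP vs].
  rewrite (bigD1_seq v) //= eqxx big1 ?addr0 // => u /negPf uv; by rewrite uv.
rewrite big_seq big1 // => u us; case: eqVneq => // uv.
by case: vs; rewrite -uv.
Qed.

Lemma sk_of_y r i :
  sk_of r * sk_y [:: i] = sk_y [:: i] * sk_of (const_term r)%:A + sk_of (delta i r).
Proof.
by rewrite sk_yof [LHS]mulU ymul_nil lmulU /= rmulD !rmulU !mulr1.
Qed.


(* R<Y_n; tau, delta> for a subalgebra R of k<<X_n>>: the sums of the y_u r_u
   with u a word in y_0, ..., y_n and r_u in R. *)
Definition skewext n (R : {pred ncser k}) : {pred skew k} := fun a =>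
  `[< forall u, a@_u \in R /\ (a@_u != 0 -> all (fun i => (i <= n)%N) u) >].

Section SkewExt.
Variables (n : nat) (R : {pred ncser k}).
Hypothesis R_alg : subalg_closed R.
Hypothesis R_delta : forall i, (i <= n)%N -> {in R, forall f, delta i f \in R}.

Local Notation inY := (all (fun i => (i <= n)%N)).
Let R1 : 1 \in R := let: And3 h _ _ := R_alg in h.
Let RZ x r s : r \in R -> s \in R -> x *: r + s \in R.
Proof. by case: R_alg => _ h _; apply: h. Qed.
Let RM r s : r \in R -> s \in R -> r * s \in R.
Proof. by case: R_alg => _ _ h; apply: h. Qed.
Let R0 : 0 \in R. Proof. by have := RZ (-1) R1 R1; rewrite scaleN1r addNr. Qed.
Let RC x : x%:A \in R. Proof. by have := RZ x R1 R0; rewrite addr0. Qed.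
Let RB r s : r \in R -> s \in R -> r - s \in R.
Proof. by move=> Rr Rs; have := RZ (-1) Rs Rr; rewrite scaleN1r addrC. Qed.
Let RD r s : r \in R -> s \in R -> r + s \in R.
Proof. by move=> Rr Rs; have := RZ 1 Rr Rs; rewrite scale1r. Qed.

Let extU r u : r \in R -> inY u -> << r *g u >> \in skewext n R.
Proof.
move=> Rr Yu; apply/asboolP => v; rewrite mcoeffU mulrb.
by case: eqVneq => [<-|_]; rewrite ?eqxx ?R0 ?Rr.
Qed.

Let extD a b : a \in skewext n R -> b \in skewext n R -> a + b \in skewext n R.
Proof.
move=> /asboolP Ra /asboolP Rb; apply/asboolP => u; rewrite mcoeffD.
have [[au Yau] [bu Ybu]] := (Ra u, Rb u); split; first exact: RD.
by case: (eqVneq a@_u 0) => [->|/Yau//]; rewrite add0r.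
Qed.

Let extB a b : a \in skewext n R -> b \in skewext n R -> a - b \in skewext n R.
Proof.
move=> /asboolP Ra /asboolP Rb; apply/asboolP => u; rewrite mcoeffB.
have [[au Yau] [bu Ybu]] := (Ra u, Rb u); split; first exact: RB.
by case: (eqVneq a@_u 0) => [->|/Yau//]; rewrite sub0r oppr_eq0.
Qed.

Let ext_sum (F : seq nat -> ncser k -> skew k) a :
    (forall u r, inY u -> r \in R -> F u r \in skewext n R) ->
  a \in skewext n R -> malg_ext F a \in skewext n R.
Proof.
move=> FR /asboolP Ra; rewrite /malg_ext big_seq; apply: (big_ind (fun b => b \in skewext n R)); [|exact: extD|].
  by apply/asboolP => u; rewrite mcoeff0 eqxx R0.
by move=> u; rewrite -mcoeff_neq0 => /(proj2 (Ra u)) Yu; apply: FR => //; case: (Ra u).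
Qed.

Fact skewext_subring : subring_closed (skewext n R).
Proof.
split; [exact: extU|exact: extB|].
have ymulR u a : inY u -> a \in skewext n R -> sk_ymul u a \in skewext n R.
  by move=> Yu; apply: ext_sum => v r Yv Rr; apply: extU; rewrite // all_cat Yu.
have rmulR r a : r \in R -> a \in skewext n R -> sk_rmul r a \in skewext n R.
  by move=> Rr; apply: ext_sum => v s Yv Rs; apply: extU => //; apply: RM.
have lmulwR v r : inY v -> r \in R -> sk_lmulw r v \in skewext n R.
  elim: v r => [|i v IH] r /=; first by move=> _ Rr; apply: extU.
  move=> Yiv Rr; have /andP[Yi Yv] := Yiv.
  by apply: extD; [apply: extU|apply: IH => //; apply: R_delta].
move=> a b Ra Rb; apply: ext_sum Ra => u r Yu Rr; apply: ymulR => //.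
by apply: ext_sum Rb => v s Yv Rs; apply: rmulR => //; apply: lmulwR.
Qed.

End SkewExt.

Lemma skewextS n (R R' : {pred ncser k}) :
  {subset R <= R'} -> {subset skewext n R <= skewext n.+1 R'}.
Proof.
move=> RR' a /asboolP Ra; apply/asboolP => u; have [/RR' au Yu] := Ra u.
by split=> // /Yu; apply: sub_all => i /leqW.
Qed.

Definition Sinf_pred (R : nat -> {pred ncser k}) : {pred skew k} := fun a =>
  `[< exists2 n, (1 <= n)%N & a \in skewext n (R n) >].

Fact Sinf_subring (R : nat -> {pred ncser k}) :
    (forall n, (1 <= n)%N -> subalg_closed (R n)) ->
    (forall n i, (1 <= n)%N -> (i <= n)%N -> {in R n, forall f, delta i f \in R n}) ->
    (forall n, (1 <= n)%N -> {subset R n <= R n.+1}) ->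
  subring_closed (Sinf_pred R).
Proof.
move=> R_alg R_delta R_incr.
have mono m n : (1 <= m)%N -> (m <= n)%N ->
    {subset skewext m (R m) <= skewext n (R n)}.
  move=> m1; elim: n => [|n IH]; first by rewrite leqNgt m1.
  rewrite leq_eqVlt => /predU1P[->//|mn] a /(IH mn).
  by apply: skewextS; apply: R_incr; apply: (leq_trans m1).
have sub n (n1 : (1 <= n)%N) : subring_closed (skewext n (R n)).
  by apply: skewext_subring; [exact: R_alg|move=> i; exact: R_delta].
have both a b : a \in Sinf_pred R -> b \in Sinf_pred R -> exists n,
    [/\ (1 <= n)%N, a \in skewext n (R n) & b \in skewext n (R n)].
  move=> /asboolP[m m1 am] /asboolP[n n1 bn]; exists (maxn m n); split.
  - by rewrite leq_max m1.
  - exact: (mono m _ m1 (leq_maxl m n)) am.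
  - exact: (mono n _ n1 (leq_maxr m n)) bn.
split.
- by apply/asboolP; exists 1%N => //; case: (sub 1%N isT).
- move=> a b /both H /H[n [n1 an bn]]; apply/asboolP; exists n => //.
  by case: (sub n n1) => _ h _; apply: h.
- move=> a b /both H /H[n [n1 an bn]]; apply/asboolP; exists n => //.
  by case: (sub n n1) => _ _ h; apply: h.
Qed.

End Skew.

Section Subring.
Variables (A : nzRingType) (P : {pred A}).

Definition subring_pred of subring_closed P : {pred A} := P.
Arguments subring_pred : simpl never.

HB.instance Definition _ (P_ring : subring_closed P) :=
  GRing.isSubringClosed.Build A (subring_pred P_ring) P_ring.

Record subring (P_ring : subring_closed P) := Subring {
  subring_val : A;
  subring_valP : subring_val \in subring_pred P_ring }.

Variable P_ring : subring_closed P.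
HB.instance Definition _ := [isSub for @subring_val P_ring].
HB.instance Definition _ := [Choice of subring P_ring by <:].
HB.instance Definition _ := [SubChoice_isSubNzRing of subring P_ring by <:].

End Subring.

Section Rings.
Variable A : nzRingType.
Implicit Types (I J : set A).

Definition right_ideal I :=
  [/\ I 0, forall x y, I x -> I y -> I (x + y) & forall x a, I x -> I (x * a)].

Definition two_sided_ideal I := right_ideal I /\ forall a x, I x -> I (a * x).

Definition maximal_right_ideal I :=
  [/\ right_ideal I, I != setT &
      forall J, right_ideal J -> (I `<=` J)%classic -> J != setT -> J = I].

Definition local_ring := exists! I, maximal_right_ideal I.

Definition simple_ring :=
  forall I, two_sided_ideal I -> I = [set 0]%classic \/ I = setT.

Definition vn_regular := forall x : A, exists y, x * y * x = x.

End Rings.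

Definition mod_iso (A : nzRingType) (M N : lmodType A) :=
  exists f : {linear M -> N}, bijective f.

(* Right A-modules are left modules over the converse ring A^c; in particular
   A^c^o is A as a right module over itself. *)

Section PrincipalRightIdeal.
Variables (A : nzRingType) (e : A).

Definition pright_pred : {pred A^c^o} := fun x => `[< exists a : A, x = e * a :> A >].

Fact pright_closed : subsemimod_closed pright_pred.
Proof.
split; first split.
- by apply/asboolP; exists 0; rewrite mulr0.
- move=> x y /asboolP[a ->] /asboolP[b ->]; apply/asboolP.
  by exists (a + b); rewrite mulrDr.
move=> c x /asboolP[a ->]; apply/asboolP.
by exists (a * (c : A)); rewrite mulrA.
Qed.

HB.instance Definition _ := GRing.isSubmodClosed.Build _ _ pright_pred pright_closed.

(* The right ideal eA, as a right module *)
Record pright := PRight {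
  pright_val : A^c^o;
  pright_valP : pright_val \in pright_pred }.

HB.instance Definition _ := [isSub for pright_val].
HB.instance Definition _ := [Choice of pright by <:].
HB.instance Definition _ := [SubChoice_isSubLmodule of pright by <:].

End PrincipalRightIdeal.

Definition infinite_idempotent (A : nzRingType) (e : A) :=
  e * e = e /\ exists g h : A,
    [/\ g * g = g /\ h * h = h, g * h = 0 /\ h * g = 0, e = g + h, h != 0 &
        @mod_iso A^c (pright e) (pright g)].

Definition purely_infinite (A : nzRingType) :=
  forall I : set A, right_ideal I -> I != [set 0]%classic ->
    exists2 e, I e & infinite_idempotent e.

Definition fin_gen (A : nzRingType) (M : lmodType A) :=
  exists (n : nat) (m : 'I_n -> M), forall x, exists c : 'I_n -> A,
    x = \sum_i c i *: m i.

Definition projective (A : nzRingType) (M : lmodType A) :=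
  forall (N N' : lmodType A) (p : {linear N -> N'}) (f : {linear M -> N'}),
    (forall y, exists x, p x = y) ->
    exists g : {linear M -> N}, forall x, p (g x) = f x.

(* Finitely generated projective left A-modules are, up to isomorphism, the
   images of the idempotent endomorphisms of the modules A^n, see [fgprojP]. *)
Record fgproj (A : nzRingType) := FGProj {
  fg_rank : nat;
  fg_mx : 'M[A]_fg_rank;
  fg_idem : fg_mx *m fg_mx = fg_mx }.

HB.instance Definition _ (A : nzRingType) := gen_eqMixin (fgproj A).
HB.instance Definition _ (A : nzRingType) := gen_choiceMixin (fgproj A).

Section FGModule.
Variables (A : nzRingType) (P : fgproj A).

Definition fgmod_pred : {pred 'rV[A]_(fg_rank P)} := fun v => v *m fg_mx P == v.

Fact fgmod_closed : subsemimod_closed fgmod_pred.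
Proof.
split; first split.
- by rewrite unfold_in mul0mx.
- by move=> u v /eqP uP /eqP vP; rewrite unfold_in mulmxDl uP vP.
by move=> c u /eqP uP; rewrite unfold_in -scalemxAl uP.
Qed.

HB.instance Definition _ :=
  GRing.isSubmodClosed.Build _ _ fgmod_pred fgmod_closed.

Record fgmod := FGMod {
  fgmod_val : 'rV[A]_(fg_rank P);
  fgmod_valP : fgmod_val \in fgmod_pred }.

HB.instance Definition _ := [isSub for fgmod_val].
HB.instance Definition _ := [Choice of fgmod by <:].
HB.instance Definition _ := [SubChoice_isSubLmodule of fgmod by <:].

End FGModule.

Arguments fgmod_pred {A} P v.

Section ModIso.
Variable A : nzRingType.

Lemma mod_iso_refl (M : lmodType A) : mod_iso M M.
Proof. by exists idfun; exists idfun. Qed.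

Lemma mod_iso_sym (M N : lmodType A) : mod_iso M N -> mod_iso N M.
Proof.
case=> f [g fK gK].
have g_lin : linear g.
  by move=> c x y; apply: (can_inj fK); rewrite gK linearP !gK.
pose gM := GRing.isLinear.Build _ _ _ _ g g_lin.
pose gL : {linear N -> M} := HB.pack g gM.
by exists gL; exists f.
Qed.

Lemma mod_iso_trans (M N Q : lmodType A) : mod_iso M N -> mod_iso N Q -> mod_iso M Q.
Proof.
by case=> f bf [g bg]; exists (g \o f : {linear M -> Q}); apply: bij_comp.
Qed.

End ModIso.

Section FGProj.
Variable A : nzRingType.
Implicit Types P Q : fgproj A.

Lemma fgmodE P (v : fgmod P) : fgmod_val v *m fg_mx P = fgmod_val v.
Proof. exact/eqP/(fgmod_valP v). Qed.

Let lincomb n (M : lmodType A) (m : 'I_n -> M) (v : 'rV[A]_n) := \sum_i v 0 i *: m i.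

Let lincomb_linear n (M : lmodType A) (m : 'I_n -> M) : linear (lincomb m).
Proof.
move=> c u v; rewrite /lincomb scaler_sumr -big_split /=.
by apply: eq_bigr => i _; rewrite !mxE scalerDl scalerA.
Qed.

Let lincombL n (M : lmodType A) (m : 'I_n -> M) : {linear 'rV[A]_n -> M} :=
  HB.pack (lincomb m) (GRing.isLinear.Build _ _ _ _ _ (lincomb_linear m)).

Let fin_gen_iso (M N : lmodType A) : mod_iso M N -> fin_gen N -> fin_gen M.
Proof.
move=> /mod_iso_sym[f [f' fK f'K]] [n [m mP]]; exists n, (f \o m) => x.
have [c xE] := mP (f' x); exists c; rewrite -[x]f'K xE raddf_sum.
by apply: eq_bigr => i _; rewrite /= linearZZ.
Qed.

Let projective_iso (M N : lmodType A) : mod_iso M N -> projective N -> projective M.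
Proof.
case=> f [f' fK f'K]; have f'_lin : linear f'.
  by move=> c x y; apply: (can_inj fK); rewrite f'K linearP !f'K.
pose f'L : {linear N -> M} := HB.pack f' (GRing.isLinear.Build _ _ _ _ _ f'_lin).
move=> Nproj L L' p h p_surj.
have [g gP] := Nproj L L' p (h \o f'L : {linear N -> L'}) p_surj.
by exists (g \o f : {linear M -> L}) => x /=; rewrite gP /= fK.
Qed.

Theorem fgprojP (M : lmodType A) :
  (fin_gen M /\ projective M) <-> exists P, mod_iso M (fgmod P).
Proof.
split=> [[[n [m mP]] Mproj]|[P MP]].
  have [x|g gP] := Mproj _ _ (lincombL m) idfun.
    have [c ->] := mP x; exists (\row_i c i).
    by apply: eq_bigr => i _; rewrite mxE.
  pose E : 'M[A]_n := \matrix_i g (m i).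
  have mulE v : v *m E = g (lincombL m v).
    rewrite mulmx_sum_row raddf_sum /=; apply: eq_bigr => i _.
    by rewrite rowK -linearZZ.
  have gE x : g x *m E = g x by rewrite mulE gP.
  have E_idem : E *m E = E by apply/row_matrixP => i; rewrite row_mul rowK gE.
  pose P := FGProj E_idem.
  have gP' x : g x \in fgmod_pred P by apply/eqP/gE.
  pose f (x : M) : fgmod P := FGMod (gP' x).
  have f_lin : linear f by move=> c x y; apply: val_inj; rewrite /= linearP.
  pose fL : {linear M -> fgmod P} :=
    HB.pack f (GRing.isLinear.Build _ _ _ _ _ f_lin).
  exists P, fL, (fun v : fgmod P => lincombL m (fgmod_val v : 'rV[A]_n)) => [x|v] /=; first exact: gP.
  by apply: val_inj => /=; rewrite -mulE; exact: (fgmodE v).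
suff [fgP projP] : fin_gen (fgmod P) /\ projective (fgmod P).
  by split; [apply: fin_gen_iso MP fgP|apply: projective_iso MP projP].
have rowP i : row i (fg_mx P) \in fgmod_pred P.
  by apply/eqP; rewrite -row_mul fg_idem.
pose e i : fgmod P := FGMod (rowP i).
have eP (v : fgmod P) : v = \sum_i fgmod_val v 0 i *: e i.
  apply: val_inj; rewrite raddf_sum /= -[LHS]fgmodE mulmx_sum_row.
  by apply: eq_bigr => i _.
split; first by exists (fg_rank P), e => v; exists (fgmod_val v 0).
move=> N N' p f p_surj.
have /choice[y yP] : forall i, exists y, p y = f (e i) by move=> i; apply: p_surj.
exists (lincombL y \o (val : {linear fgmod P -> 'rV[A]_(fg_rank P)})) => v.
rewrite /= [in RHS](eP v) !raddf_sum; apply: eq_bigr => i _.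
by rewrite /= !linearZZ /= yP.
Qed.

Fact fgdsum_idem P Q :
  let E := block_mx (fg_mx P) 0 0 (fg_mx Q) in E *m E = E.
Proof. by rewrite /= mulmx_block !mulmx0 !mul0mx !addr0 !add0r !fg_idem. Qed.

Definition fgdsum P Q := FGProj (fgdsum_idem P Q).

Definition fgfree n : fgproj A := FGProj (mulmx1 (1%:M : 'M[A]_n)).

Lemma fgdsumP P Q : mod_iso (fgmod (fgdsum P Q)) (fgmod P * fgmod Q)%type.
Proof.
have mulE (v : 'rV[A]_(fg_rank P + fg_rank Q)) : v *m fg_mx (fgdsum P Q) =
    row_mx (lsubmx v *m fg_mx P) (rsubmx v *m fg_mx Q).
  by rewrite -{1}(hsubmxK v) mul_row_block !mulmx0 addr0 add0r.
have lP (v : fgmod (fgdsum P Q)) : lsubmx (fgmod_val v) \in fgmod_pred P.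
  by apply/eqP; rewrite -[in RHS]fgmodE mulE row_mxKl.
have rP (v : fgmod (fgdsum P Q)) : rsubmx (fgmod_val v) \in fgmod_pred Q.
  by apply/eqP; rewrite -[in RHS]fgmodE mulE row_mxKr.
have rowP (x : fgmod P * fgmod Q) :
    row_mx (fgmod_val x.1) (fgmod_val x.2) \in fgmod_pred (fgdsum P Q).
  by apply/eqP; rewrite mulE row_mxKl row_mxKr !fgmodE.
pose f v : (fgmod P * fgmod Q)%type := (FGMod (lP v), FGMod (rP v)).
have f_lin : linear f.
  by move=> c u v; congr pair; apply: val_inj; rewrite /= linearP.
pose fL : {linear fgmod (fgdsum P Q) -> (fgmod P * fgmod Q)%type} :=
  HB.pack f (GRing.isLinear.Build _ _ _ _ _ f_lin).
exists fL, (fun x => FGMod (rowP x)) => [v|[x y]].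
  by apply: val_inj; rewrite /= hsubmxK.
by congr pair; apply: val_inj; rewrite /= ?row_mxKl ?row_mxKr.
Qed.

Lemma fgfreeP n : mod_iso (fgmod (fgfree n)) 'rV[A]_n.
Proof.
have inP (v : 'rV[A]_n) : v \in fgmod_pred (fgfree n) by apply/eqP/mulmx1.
exists (val : {linear fgmod (fgfree n) -> 'rV[A]_n}).
by exists (fun v => FGMod (inP v)) => [v|v //]; apply: val_inj.
Qed.

Lemma regular_rV1 : mod_iso A^o 'rV[A]_1.
Proof.
pose f (a : A^o) : 'rV[A]_1 := const_mx a.
have f_lin : linear f by move=> c x y; apply/matrixP => i j; rewrite !mxE.
pose fL : {linear A^o -> 'rV[A]_1} :=
  HB.pack f (GRing.isLinear.Build _ _ _ _ _ f_lin).
exists fL, (fun v : 'rV[A]_1 => v 0 0) => [x|v] /=; first by rewrite mxE.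
by apply/rowP => i; rewrite mxE (ord1 i).
Qed.

Definition fgiso P Q := `[< mod_iso (fgmod P) (fgmod Q) >].

Fact fgiso_refl : reflexive fgiso.
Proof. by move=> P; apply/asboolP/mod_iso_refl. Qed.
Fact fgiso_sym : symmetric fgiso.
Proof.
by move=> P Q; apply/asboolP/asboolP => /mod_iso_sym.
Qed.
Fact fgiso_trans : transitive fgiso.
Proof.
by move=> P Q S /asboolP QP /asboolP PS; apply/asboolP/(mod_iso_trans QP PS).
Qed.

Canonical fgiso_equiv := EquivRel fgiso fgiso_refl fgiso_sym fgiso_trans.

End FGProj.

(* The monoid of isomorphism classes of f.g. projective left A-modules *)
Definition proj_monoid (A : nzRingType) := {eq_quot @fgiso A}.

HB.instance Definition _ (A : nzRingType) := EqQuotient.on (proj_monoid A).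
HB.instance Definition _ (A : nzRingType) := Choice.on (proj_monoid A).

Section ProjMonoid.
Variable A : nzRingType.
Local Notation V := (proj_monoid A).
Implicit Types P Q : fgproj A.

Definition iso_class P : V := \pi_V P.

Lemma iso_classP P Q : iso_class P = iso_class Q <-> mod_iso (fgmod P) (fgmod Q).
Proof.
split=> [/eqmodP/asboolP//|PQ]; apply/eqmodP; exact/asboolP.
Qed.

Let prod_iso (M M' N N' : lmodType A) :
  mod_iso M M' -> mod_iso N N' -> mod_iso (M * N)%type (M' * N')%type.
Proof.
case=> f [f' fK f'K] [g [g' gK g'K]].
pose h (x : M * N) : (M' * N')%type := (f x.1, g x.2).
have h_lin : linear h by move=> c x y; congr pair; rewrite /= linearP.
pose hL : {linear (M * N)%type -> (M' * N')%type} :=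
  HB.pack h (GRing.isLinear.Build _ _ _ _ _ h_lin).
by exists hL, (fun x => (f' x.1, g' x.2)) => -[x y]; rewrite /hL /= /h /= ?fK ?gK ?f'K ?g'K.
Qed.

Let dsum_iso P P' Q Q' : mod_iso (fgmod P) (fgmod P') ->
  mod_iso (fgmod Q) (fgmod Q') -> mod_iso (fgmod (fgdsum P Q)) (fgmod (fgdsum P' Q')).
Proof.
move=> PP' QQ'; apply: (mod_iso_trans (fgdsumP P Q)).
by apply: (mod_iso_trans (prod_iso PP' QQ')); apply/mod_iso_sym/fgdsumP.
Qed.

Definition proj_add (x y : V) : V := iso_class (fgdsum (repr x) (repr y)).
Definition proj_zero : V := iso_class (fgfree A 0).

Let repr_iso P : mod_iso (fgmod (repr (iso_class P))) (fgmod P).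
Proof. by apply/iso_classP; apply: reprK. Qed.

Let addE P Q : proj_add (iso_class P) (iso_class Q) = iso_class (fgdsum P Q).
Proof. by apply/iso_classP/dsum_iso; apply: repr_iso. Qed.

Let classK (x : V) : iso_class (repr x) = x. Proof. exact: reprK. Qed.

Let addA : associative proj_add.
Proof.
move=> x y z; rewrite -(classK x) -(classK y) -(classK z) !addE; apply/iso_classP.
set P := repr x; set Q := repr y; set S := repr z.
apply: (mod_iso_trans (fgdsumP _ _)).
apply: (mod_iso_trans (prod_iso (mod_iso_refl _) (fgdsumP _ _))).
apply/mod_iso_sym/(mod_iso_trans (fgdsumP _ _)).
apply: (mod_iso_trans (prod_iso (fgdsumP _ _) (mod_iso_refl _))).
pose f (x : fgmod P * fgmod Q * fgmod S) :
  (fgmod P * (fgmod Q * fgmod S))%type := (x.1.1, (x.1.2, x.2)).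
have f_lin : linear f by [].
pose fL : {linear (fgmod P * fgmod Q * fgmod S)%type -> (fgmod P * (fgmod Q * fgmod S))%type} :=
  HB.pack f (GRing.isLinear.Build _ _ _ _ _ f_lin).
by exists fL, (fun x => (x.1, x.2.1, x.2.2)) => [[[]]|[? []]].
Qed.

Let addC : commutative proj_add.
Proof.
move=> x y; rewrite -(classK x) -(classK y) !addE; apply/iso_classP.
apply: (mod_iso_trans (fgdsumP _ _)).
apply/mod_iso_sym/(mod_iso_trans (fgdsumP _ _)).
pose f (z : fgmod (repr y) * fgmod (repr x)) : (fgmod (repr x) * fgmod (repr y))%type :=
  (z.2, z.1).
have f_lin : linear f by [].
pose fL : {linear (fgmod (repr y) * fgmod (repr x))%type -> (fgmod (repr x) * fgmod (repr y))%type} :=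
  HB.pack f (GRing.isLinear.Build _ _ _ _ _ f_lin).
by exists fL, (fun z => (z.2, z.1)) => [[]|[]].
Qed.

Let add0 : left_id proj_zero proj_add.
Proof.
move=> x; rewrite -(classK x) addE; apply/iso_classP.
apply: (mod_iso_trans (fgdsumP _ _)).
pose f (z : fgmod (fgfree A 0) * fgmod (repr x)) : fgmod (repr x) := z.2.
have f_lin : linear f by [].
pose fL : {linear (fgmod (fgfree A 0) * fgmod (repr x))%type -> fgmod (repr x)} :=
  HB.pack f (GRing.isLinear.Build _ _ _ _ _ f_lin).
exists fL, (fun z => (0, z)) => [[u z]|z] //=; congr pair; apply: val_inj => /=.
by apply/rowP => -[].
Qed.

HB.instance Definition _ := GRing.isNmodule.Build V addA addC add0.

Lemma iso_classD P Q : iso_class (fgdsum P Q) = iso_class P + iso_class Q.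
Proof. by rewrite -[RHS]/(proj_add _ _) addE. Qed.

End ProjMonoid.

Section Grothendieck.
Variable V : nmodType.


Definition groth_eq (x y : V * V) := `[< exists c, x.1 + y.2 + c = y.1 + x.2 + c >].

Fact groth_eq_refl : reflexive groth_eq.
Proof. by move=> x; apply/asboolP; exists 0. Qed.
Fact groth_eq_sym : symmetric groth_eq.
Proof. by move=> x y; apply/asboolP/asboolP => -[c xy]; exists c. Qed.
Fact groth_eq_trans : transitive groth_eq.
Proof.
move=> [y1 y2] [x1 x2] [z1 z2] /asboolP[c /= xy] /asboolP[d /= yz].
apply/asboolP; exists (y1 + y2 + c + d) => /=.
rewrite [LHS](AC (2*4) ((1*4*5)*(3*2*6)))%AC /= xy yz.
by rewrite [LHS](AC (3*3) ((4*2)*(1*5*3*6)))%AC.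
Qed.

Canonical groth_equiv :=
  EquivRel groth_eq groth_eq_refl groth_eq_sym groth_eq_trans.

Definition groth := {eq_quot groth_eq}.

HB.instance Definition _ := EqQuotient.on groth.
HB.instance Definition _ := Choice.on groth.

(* The class of the formal difference x - y *)
Definition groth_diff (x y : V) : groth := \pi_groth (x, y).

Lemma groth_diffP x y x' y' : groth_diff x y = groth_diff x' y' <->
  exists c, x + y' + c = x' + y + c.
Proof.
split=> [/eqmodP/asboolP//|xy]; apply/eqmodP; exact/asboolP.
Qed.

Definition groth_zero := groth_diff 0 0.
Definition groth_opp (a : groth) := groth_diff (repr a).2 (repr a).1.
Definition groth_add (a b : groth) :=
  groth_diff ((repr a).1 + (repr b).1) ((repr a).2 + (repr b).2).

Let diffK a : groth_diff (repr a).1 (repr a).2 = a.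
Proof. by rewrite /groth_diff -surjective_pairing; apply: reprK. Qed.

Let diff_repr x y : exists c,
  (repr (groth_diff x y)).1 + y + c = x + (repr (groth_diff x y)).2 + c.
Proof. exact/groth_diffP/diffK. Qed.

Let addE x y x' y' :
  groth_add (groth_diff x y) (groth_diff x' y') = groth_diff (x + x') (y + y').
Proof.
have [c xy] := diff_repr x y; have [d xy'] := diff_repr x' y'.
apply/groth_diffP; exists (c + d).
rewrite [LHS](AC (2*2*2) ((1*3*5)*(2*4*6)))%AC /= xy xy'.
by rewrite [LHS](AC (3*3) ((1*4)*(2*5)*(3*6)))%AC.
Qed.

Let oppE x y : groth_opp (groth_diff x y) = groth_diff y x.
Proof.
have [c xy] := diff_repr x y; apply/groth_diffP; exists c.
by rewrite addrC [X in _ + X]addrC addrC -xy; congr (_ + _); rewrite addrC.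
Qed.

Let addA : associative groth_add.
Proof. by move=> a b c; rewrite -(diffK a) -(diffK b) -(diffK c) !addE !addrA. Qed.

Let addC : commutative groth_add.
Proof.
move=> a b; rewrite -(diffK a) -(diffK b) !addE.
by congr groth_diff; rewrite addrC.
Qed.

Let add0 : left_id groth_zero groth_add.
Proof. by move=> a; rewrite -(diffK a) addE !add0r. Qed.

Let addN : left_inverse groth_zero groth_opp groth_add.
Proof.
move=> a; rewrite -(diffK a) oppE addE; apply/groth_diffP; exists 0.
by rewrite !addr0 add0r addrC.
Qed.

HB.instance Definition _ := GRing.isZmodule.Build groth addA addC add0 addN.

Definition groth_of x := groth_diff x 0.

Lemma groth_ofD x y : groth_of (x + y) = groth_of x + groth_of y.
Proof. by rewrite -[RHS]/(groth_add _ _) addE addr0. Qed.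

Lemma groth_diffE x y : groth_diff x y = groth_of x - groth_of y.
Proof.
by rewrite -[RHS]/(groth_add _ (groth_opp _)) oppE addE addr0 add0r.
Qed.

End Grothendieck.

(* K_0 of the category of finitely generated projective right A-modules, i.e. of
   left modules over A^c *)
Definition K0 (A : nzRingType) := groth (proj_monoid A^c).

HB.instance Definition _ (A : nzRingType) := GRing.Zmodule.on (K0 A).

(* The class [A] of the free module of rank 1, see [fgfreeP] and [regular_rV1] *)
Definition K0_unit (A : nzRingType) : K0 A := groth_of (iso_class (fgfree A^c 1)).

Definition infinite_cyclic_with_generator (G : zmodType) (g : G) :=
  (forall x, exists m : int, x = g *~ m) /\ (forall m : int, g *~ m = 0 -> m = 0).

(* Main.v *)
From HB Require Import structures.
Require Import Defs.
From mathcomp Require Import all_boot all_order all_algebra.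
From mathcomp Require Import finmap monalg boolp classical_sets.

Set Implicit Arguments.
Unset Strict Implicit.
Unset Printing Implicit Defensive.

Import Defs GRing.Theory.
Local Open Scope ring_scope.

(** Write tau for the constant term and S for S_inf.  In S one has
    x_i y_j = delta_ij, and each S_n contains the idempotent
    e_n = 1 - sum_(i <= n) y_i x_i, for which x_i e_n = 0 = e_n y_i when i <= n.
    Since r = tau(r) + sum_i delta_i(r) x_i for r in R_n, also r e_n = tau(r) e_n.

    For a word v, let x_v denote the product of the x's, in reverse order, for which
    x_v y_v = 1.

    Simplicity and pure infiniteness.  For every a != 0 there are s and t with
    s a t = 1.  If y_v r with r != 0 is a term of a with v of minimal length,
    multiplying on the left by x_v and then by x_N, with N beyond all the letters
    of a, leaves x_N r; and if w is a shortest word occurring in r, then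
    x_N r y_(rev w) y_N is a nonzero scalar.  A nonzero ideal therefore contains
    1, and a nonzero right ideal contains an idempotent f with fS isomorphic to
    S, which is infinite because x_0 y_0 = 1 and y_0 x_0 != 1.

    Regularity and generation of K_0.  If b satisfies b a b = b, then a is
    regular as soon as a - a b a is, and the module aS is the direct sum of abS
    and a copy of (a - a b a)S ([cyclic_regular_step]).  Expanding
    1 = sum_(|v| = m) y_v x_v + sum_(|v| < m) y_v e_n x_v puts a in S_n in the
    form sum_(|v| = m) y_v r_v + sum_(|v| < m) y_v e_n t_v with r_v, t_v in R_n.
    Terms of this form can be removed one at a time.  As R_n is local, a series
    with nonzero constant term is invertible in it; so if w is a shortest word
    occurring in the family of the r_v, and occurs in r_v, then r_v y_(rev w) is a
    unit s of R_n, and b = y_(rev w) s^-1 x_v removes the term y_v r_v, with abS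
    isomorphic to S.  When only the terms y_v e_n t_v remain, and c is a nonzero
    coefficient of t_v, at the word w, then b = y_(rev w) e_n c^-1 x_v removes the
    term at v, with abS isomorphic to e_n S.  Hence a is regular, and aS is a
    direct sum of copies of S and e_n S.  As [e_n S] = -n [S], the class of aS is an
    integer multiple of [S].  Every finitely generated projective module is
    isomorphic to some fS, f idempotent, because S contains S^m as a direct
    summand for all m; so [S] generates K_0(S).

    [S] has infinite order.  A relation m [S] = 0 with m >= 0 gives
    S^(m+1) isomorphic to S, that is, xi_i and eta_i for 0 <= i <= m with
    xi_i eta_j = delta_ij and sum_i eta_i xi_i = 1.  That m = 0 is an index
    computation ([skew_cuntz_rank1]).  The series form a right S-module, with
    y_i acting as delta_i; there is a second action of S, through the components
    r_i in r = tau(r) + sum_i x_i r_i, for which 1 acts as r |-> r - tau(r).  The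
    two actions of any given element differ by an operator of finite rank, so
    H(r) = sum_i (r eta_i) xi_i, with the second action on the inside and the
    first on the outside, is the identity plus an operator of finite rank and has
    index 0.  But its kernel consists of constants, and its cokernel has
    dimension at least m + 1. *)

(** * Idempotents and the monoid of projective modules *)

Section MatrixProjectives.
Variable B : nzRingType.

Lemma fgmod_iso_mx (P Q : fgproj B) (M : 'M[B]_(fg_rank P, fg_rank Q))
    (N : 'M[B]_(fg_rank Q, fg_rank P)) :
  M *m N = fg_mx P -> N *m M = fg_mx Q -> mod_iso (fgmod P) (fgmod Q).
Proof.
move=> MN NM.
have fP (v : fgmod P) : fgmod_val v *m M \in fgmod_pred Q.
  by apply/eqP; rewrite -NM mulmxA -(mulmxA _ M) MN (fgmodE v).
have gP (v : fgmod Q) : fgmod_val v *m N \in fgmod_pred P.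
  by apply/eqP; rewrite -MN mulmxA -(mulmxA _ N) NM (fgmodE v).
have f_lin : linear (fun v => FGMod (fP v)).
  by move=> c u v; apply: val_inj; rewrite /= mulmxDl -scalemxAl.
pose f : {linear fgmod P -> fgmod Q} :=
  HB.pack (fun v => FGMod (fP v)) (GRing.isLinear.Build _ _ _ _ _ f_lin).
exists f, (fun v => FGMod (gP v)) => v; apply: val_inj => /=.
  by rewrite -mulmxA MN (fgmodE v).
by rewrite -mulmxA NM (fgmodE v).
Qed.

Lemma iso_class_fgfreeS n :
  iso_class (fgfree B n.+1) = iso_class (fgfree B 1) + iso_class (fgfree B n).
Proof.
rewrite -iso_classD; apply/iso_classP.
apply: (@fgmod_iso_mx (fgfree B n.+1) (fgdsum (fgfree B 1) (fgfree B n))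
  (1%:M : 'M_(1 + n)) (1%:M : 'M_(1 + n))) => /=.
  by rewrite mulmx1.
by rewrite mulmx1 scalar_mx_block.
Qed.

(** The entries of an isomorphism between B^n and B and of its inverse. *)
Lemma fgfree_iso_cuntz n : mod_iso (fgmod (fgfree B n)) (fgmod (fgfree B 1)) ->
  exists xi eta : 'I_n -> B,
    (forall i j, eta i * xi j = (i == j)%:R) /\ \sum_i xi i * eta i = 1.
Proof.
move=> isoF; have : mod_iso 'rV[B]_n 'rV[B]_1.
  apply: mod_iso_trans (fgfreeP B 1); apply: mod_iso_trans isoF.
  exact/mod_iso_sym/fgfreeP.
case=> f [g fK gK].
pose xi i := g 1%:M 0 i; pose eta i := f (delta_mx 0 i) 0 0.
have fE v : f v = \sum_i v 0 i *: f (delta_mx 0 i).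
  by rewrite [in LHS](row_sum_delta v) raddf_sum; apply: eq_bigr => i _; rewrite /= linearZZ.
exists xi, eta; split=> [i j|].
  have : eta i *: g 1%:M = delta_mx 0 i.
    apply: (can_inj fK); rewrite linearZZ /= gK.
    by apply/rowP => l; rewrite !mxE (ord1 l) mulr1.
  by move/rowP/(_ j); rewrite !mxE eqxx /= eq_sym.
have /rowP/(_ 0) := gK 1%:M; rewrite fE summxE [in RHS]mxE eqxx mulr1n => <-.
by apply: eq_bigr => i _; rewrite !mxE.
Qed.

End MatrixProjectives.

Section IdempotentClass.
Variable A : nzRingType.
Implicit Types a b c e f : A.

Fact idem_mx e : e * e = e -> (e%:M : 'M[A^c]_1) *m e%:M = e%:M.
Proof. by move=> ee; rewrite -scalar_mxM; congr (_%:M). Qed.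

(** The class of the right module eA; the default value 0 makes it a total
    function, so that classes are written without proofs of idempotence. *)
Definition idem_class e : proj_monoid A^c :=
  if @eqP _ (e * e) e is ReflectT ee then iso_class (FGProj (idem_mx ee)) else 0.

Lemma idem_classE e (ee : e * e = e) : idem_class e = iso_class (FGProj (idem_mx ee)).
Proof.
rewrite /idem_class; case: eqP => // ee'.
by congr (iso_class (FGProj (idem_mx _))); apply: Prop_irrelevance.
Qed.

(** Multiplication by b is an isomorphism from eA to fA, with inverse
    multiplication by a. *)
Lemma idem_class_equiv a b e f : e * e = e -> f * f = f ->
  a * b = e -> b * a = f -> idem_class e = idem_class f.
Proof.
move=> ee ff ab ba; rewrite (idem_classE ee) (idem_classE ff).
apply/iso_classP.
apply: (@fgmod_iso_mx _ (FGProj (idem_mx ee)) (FGProj (idem_mx ff)) b%:M a%:M).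
  by rewrite -scalar_mxM; congr (_%:M).
by rewrite -scalar_mxM; congr (_%:M).
Qed.

Lemma idem_classD e f : e * e = e -> f * f = f -> e * f = 0 -> f * e = 0 ->
  idem_class (e + f) = idem_class e + idem_class f.
Proof.
move=> ee ff ef fe.
have gg : (e + f) * (e + f) = e + f by rewrite mulrDl !mulrDr ee ff ef fe addr0 add0r.
rewrite (idem_classE ee) (idem_classE ff) (idem_classE gg) -iso_classD.
apply/iso_classP.
apply: (@fgmod_iso_mx _ (FGProj (idem_mx gg))
  (fgdsum (FGProj (idem_mx ee)) (FGProj (idem_mx ff)))
  (row_mx e%:M f%:M) (col_mx e%:M f%:M)) => /=.
  rewrite mul_row_col -!scalar_mxM -raddfD; congr (_%:M).
  by rewrite -[RHS]/(e + f) -[in RHS]ee -[in RHS]ff.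
rewrite mul_col_row -!scalar_mxM; congr block_mx.
- by congr (_%:M).
- by rewrite -(raddf0 (@scalar_mx A^c 1)); congr (_%:M).
- by rewrite -(raddf0 (@scalar_mx A^c 1)); congr (_%:M).
- by congr (_%:M).
Qed.

Lemma idem_class1 : idem_class 1 = iso_class (fgfree A^c 1).
Proof.
rewrite (idem_classE (mulr1 1)); apply/iso_classP.
by apply: (@fgmod_iso_mx _ (FGProj (idem_mx (mulr1 1))) (fgfree A^c 1) 1%:M 1%:M);
  rewrite mulmx1.
Qed.

Lemma idem_class0 : idem_class 0 = 0.
Proof.
rewrite (idem_classE (mulr0 0)); apply/iso_classP.
apply: (@fgmod_iso_mx _ (FGProj (idem_mx (mulr0 0))) (fgfree A^c 0) 0 0);
  last by apply/matrixP => -[[]].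
by rewrite mulmx0; apply/esym/(raddf0 (@scalar_mx A^c 1)).
Qed.

Variables x y : nat -> A.
Hypothesis xy : forall i j, x i * y j = (i == j)%:R.

(** The row of the y_i and the column of the x_i embed A^m in A as a direct
    summand, and turn an idempotent matrix into an idempotent element. *)
Lemma proj_idem (p : proj_monoid A^c) : exists2 f, f * f = f & p = idem_class f.
Proof.
have -> : p = iso_class (repr p) by apply/esym/reprK.
case: (repr p) => m E EE.
pose C : 'M[A^c]_(m, 1) := \col_i y i.
pose D : 'M[A^c]_(1, m) := \row_j x j.
have CD : C *m D = 1%:M.
  by apply/matrixP => i j; rewrite !mxE big_ord1 !mxE; apply: etrans (xy j i) _; rewrite eq_sym.
have FF : (D *m E *m C) *m (D *m E *m C) = D *m E *m C.
  by rewrite !mulmxA -(mulmxA _ C) CD mulmx1 -(mulmxA D) EE.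
have [f fE] : exists f : A^c, D *m E *m C = f%:M.
  by exists ((D *m E *m C) 0 0); rewrite [LHS]mx11_scalar.
have ff : (f : A) * f = f.
  by move: FF; rewrite fE -scalar_mxM => /matrixP/(_ 0 0); rewrite !mxE eqxx !mulr1n.
exists f => //; rewrite (idem_classE ff); apply/iso_classP.
apply: (@fgmod_iso_mx _ (FGProj EE) (FGProj (idem_mx ff)) (E *m C) (D *m E)).
  by rewrite mulmxA -(mulmxA E) CD mulmx1.
by rewrite mulmxA -(mulmxA D) EE fE.
Qed.

Definition cyclic_class e := exists m : int, groth_of (idem_class e) = K0_unit A *~ m.

(** Regularity of a, together with the fact that aA, which is abA, has its class
    in the subgroup generated by [A]: one induction proves both. *)
Definition cyclic_regular a := exists b, a * b * a = a /\ cyclic_class (a * b).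

Lemma cyclic_regular0 : cyclic_regular 0.
Proof. by exists 0; rewrite !mulr0; split=> //; exists 0; rewrite idem_class0. Qed.

(** With b = gamma beta one has b a b = b, and the module abA is isomorphic to pA.
    If d is a quasi-inverse of c = a - a b a, then
    a b' = a b + c d (1 - a b) for b' = b + (1 - b a) d (1 - a b), and the two
    summands are orthogonal idempotents; the second one has the class of c d. *)
Lemma cyclic_regular_step a beta gamma p :
    p * p = p -> cyclic_class p -> beta * a * gamma = p -> p * beta = beta ->
  cyclic_regular (a - a * (gamma * beta) * a) -> cyclic_regular a.
Proof.
move=> pp [m pm] bac pb [d []].
have [b bE] : exists b, b = gamma * beta by eexists.
have [g gE] : exists g, g = a * b by eexists.
have [c cE] : exists c, c = (1 - g) * a by eexists.
have -> : a - a * (gamma * beta) * a = c by rewrite cE gE bE mulrBl mul1r.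
move=> cdc [l cl].
have bab : b * a * b = b.
  by rewrite bE !mulrA -(mulrA gamma) -(mulrA gamma) bac -mulrA pb.
have gg : g * g = g by rewrite gE -(mulrA a) (mulrA b) bab.
have gc : g * c = 0 by rewrite cE mulrA mulrBr mulr1 gg subrr mul0r.
have [h hE] : exists h, h = c * d * (1 - g) by eexists.
have gh : g * h = 0 by rewrite hE !mulrA gc !mul0r.
have hg : h * g = 0 by rewrite hE -mulrA mulrBl mul1r gg subrr mulr0.
have kc : (1 - g) * c = c by rewrite mulrBl mul1r gc subr0.
have ss : (c * d) * (c * d) = c * d by rewrite mulrA cdc.
have hs : h * (c * d) = c * d by rewrite hE -mulrA (mulrA (1 - g)) kc ss.
have sh : (c * d) * h = h by rewrite hE mulrA ss.
have hh : h * h = h by rewrite {2}hE mulrA hs.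
exists (b + (1 - b * a) * d * (1 - g)).
have abE : a * (b + (1 - b * a) * d * (1 - g)) = g + h.
  rewrite mulrDr -gE hE cE gE; congr (_ + _); rewrite !mulrA; congr (_ * d * _).
  by rewrite mulrBr mulrBl mulr1 mul1r !mulrA.
split.
  by rewrite abE mulrDl hE -(mulrA (c * d)) -cE cdc cE mulrBl mul1r addrC subrK.
exists (m + l); rewrite abE mulrzDr idem_classD // groth_ofD; congr (_ + _).
  rewrite -pm; congr groth_of; apply: (idem_class_equiv (a := a * gamma) (b := beta)) => //.
    by rewrite gE bE mulrA.
  by rewrite mulrA.
by rewrite -cl; congr groth_of; apply: (idem_class_equiv (a := c * d) (b := h)).
Qed.

Lemma cyclic_regular_idem f : f * f = f -> cyclic_regular f -> cyclic_class f.
Proof.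
move=> ff [b [fbf [m mE]]]; exists m; rewrite -mE; congr groth_of.
apply: (idem_class_equiv (a := f * b) (b := f)) => //; last by rewrite mulrA ff.
by rewrite mulrA fbf.
Qed.

Lemma K0_cyclic : (forall a, cyclic_regular a) ->
  forall z : K0 A, exists m : int, z = K0_unit A *~ m.
Proof.
move=> reg z; have projE (p : proj_monoid A^c) :
    exists m : int, groth_of p = K0_unit A *~ m.
  have [f ff fE] := proj_idem p.
  have [m mE] := cyclic_regular_idem ff (reg f).
  by exists m; rewrite fE.
have -> : z = groth_diff (repr z).1 (repr z).2.
  by rewrite /groth_diff -surjective_pairing; apply/esym/reprK.
rewrite groth_diffE; have [[m ->] [l ->]] := (projE (repr z).1, projE (repr z).2).
by exists (m - l); rewrite mulrzBr.
Qed.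

(** A relation n [A] = 0 reads n A + C = C in the monoid of projectives; adding a
    complement of C in A turns it into A^(n+1) = A. *)
Lemma K0_unit_order :
    (forall n (xi eta : 'I_n.+1 -> A), (forall i j, xi i * eta j = (i == j)%:R) ->
       \sum_i eta i * xi i = 1 -> n = 0%N) ->
  forall m : int, K0_unit A *~ m = 0 -> m = 0.
Proof.
move=> ibn; suff ord n : K0_unit A *+ n = 0 -> n = 0%N.
  by case=> n; [move/ord->|rewrite NegzE mulrNz => /eqP; rewrite oppr_eq0 => /eqP/ord].
have unitE : K0_unit A *+ n = groth_of (iso_class (fgfree A^c 1) *+ n).
  by elim: n => [//|n IH]; rewrite !mulrS groth_ofD IH.
rewrite unitE => /groth_diffP[c]; rewrite !addr0 add0r => ncE.
have [f ff fE] := proj_idem c.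
have f'f' : (1 - f) * (1 - f) = 1 - f.
  by rewrite mulrBr mulr1 mulrBl mul1r ff subrr subr0.
have := idem_classD ff f'f'.
rewrite mulrBr mulr1 mulrBl mul1r ff subrr => /(_ erefl erefl).
rewrite addrC subrK idem_class1 -fE => uE.
have freeE : iso_class (fgfree A^c n.+1) = iso_class (fgfree A^c 1) *+ n.+1.
  elim: (n) => [|l IH]; first by rewrite mulr1n.
  by rewrite iso_class_fgfreeS IH -mulrS.
have : iso_class (fgfree A^c n.+1) = iso_class (fgfree A^c 1).
  by rewrite freeE mulrSr [X in _ + X]uE addrA ncE -uE.
move/iso_classP => /fgfree_iso_cuntz[xi [eta [xieta sum1]]].
apply: (ibn n xi eta) => [i j|]; last exact: sum1.
by rewrite eq_sym; apply: xieta.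
Qed.

End IdempotentClass.

(** * Simple and purely infinite rings *)
Section PurelyInfinite.
Variable A : nzRingType.
Implicit Types a b e f : A.

Lemma pright_iso a b e f : a * b = f -> b * a = e -> e * e = e -> f * f = f ->
  @mod_iso A^c (pright e) (pright f).
Proof.
move=> ab ba ee ff.
have fP (z : pright e) : a * (pright_val z : A) \in pright_pred f.
  have /asboolP[c ->] := pright_valP z; apply/asboolP; exists (a * c).
  by rewrite -{1}ba -{1}ab !mulrA.
have gP (z : pright f) : b * (pright_val z : A) \in pright_pred e.
  have /asboolP[c ->] := pright_valP z; apply/asboolP; exists (b * c).
  by rewrite -{1}ab -{1}ba !mulrA.
have h_lin : linear (fun z => PRight (fP z)).
  move=> c u v; apply: val_inj => /=; rewrite [LHS]mulrDr; congr (_ + _).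
  exact: (mulrA a (pright_val u : A) (c : A)).
pose h : {linear pright e -> pright f} :=
  HB.pack (fun z => PRight (fP z)) (GRing.isLinear.Build _ _ _ _ _ h_lin).
exists h, (fun z => PRight (gP z)) => z; apply: val_inj => /=;
  have /asboolP[c ->] := pright_valP z.
  by rewrite mulrA ba mulrA ee.
by rewrite mulrA ab mulrA ff.
Qed.

Hypothesis two_sided_inverses : forall a, a != 0 -> exists s t, s * a * t = 1.

Lemma simple_of_two_sided_inverses : simple_ring A.
Proof.
move=> I [[I0 ID IM] MI]; have [[a Ia a0]|I_0] := pselect (exists2 a, I a & a != 0).
  right; apply/seteqP; split=> // z _; have [s [t sat]] := two_sided_inverses a0.
  by rewrite -[z]mul1r -sat; apply/IM/IM/MI.
left; apply/seteqP; split=> [z Iz|_ -> //].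
by have [//|z0] := eqVneq z 0; case: I_0; exists z.
Qed.

(** From s a t = 1 the element u = a t of the right ideal satisfies s u = 1, so
    q |-> u q s is a multiplicative embedding that carries the infinite
    idempotent 1 = y0 x0 + (1 - y0 x0) into the ideal. *)
Lemma purely_infinite_of_two_sided_inverses (x0 y0 : A) :
  x0 * y0 = 1 -> y0 * x0 != 1 -> purely_infinite A.
Proof.
move=> xy yx I [I0 ID IM] I_neq0.
have [[a Ia a0]|I_0] := pselect (exists2 a, I a & a != 0); last first.
  case/eqP: I_neq0; apply/seteqP; split=> [z Iz|_ -> //].
  by have [//|z0] := eqVneq z 0; case: I_0; exists z.
have [s [t sat]] := two_sided_inverses a0.
have [u su Iu] : exists2 u, s * u = 1 & I u by exists (a * t); [rewrite mulrA|apply: IM].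
have corner p q : (u * p * s) * (u * q * s) = u * (p * q) * s.
  by rewrite !mulrA -(mulrA (u * p)) su mulr1.
exists (u * 1 * s); first by rewrite mulr1; apply: IM.
split; first by rewrite corner mulr1.
have gg : y0 * x0 * (y0 * x0) = y0 * x0 by rewrite mulrA -(mulrA y0) xy mulr1.
exists (u * (y0 * x0) * s), (u * (1 - y0 * x0) * s); split.
- by rewrite !corner gg mulrBr mulr1 mulrBl mul1r gg subrr subr0.
- by rewrite !corner mulrBr mulr1 mulrBl mul1r gg subrr mulr0 mul0r.
- by rewrite -mulrDl -mulrDr addrC subrK.
- apply: contra_neq yx => h0; apply/esym/eqP; rewrite -subr_eq0; apply/eqP.
  have <- : s * (u * (1 - y0 * x0) * s) * u = 1 - y0 * x0.
    by rewrite !mulrA su mul1r -mulrA su mulr1.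
  by rewrite h0 mulr0 mul0r.
- apply: (pright_iso (a := u * y0 * s) (b := u * x0 * s)); rewrite corner ?xy //.
  + by rewrite mulr1.
  + by rewrite gg.
Qed.

End PurelyInfinite.

(** * Units of a local ring of series *)
Section LocalRing.
Variable A : nzRingType.
Implicit Types (I J : set A) (a b : A).

(** Zorn, applied to the right ideals that contain a but not 1; the right ideal
    aA is one of them. *)
Lemma maximal_right_ideal_over a : (forall b, a * b != 1) ->
  exists2 J, maximal_right_ideal J & J a.
Proof.
move=> a_ninv; pose proper J := [/\ right_ideal J, J a & ~ J 1].
have full J : right_ideal J -> J 1 -> J = setT.
  by case=> _ _ JM J1; apply/seteqP; split=> // b _; rewrite -[b]mul1r; apply: JM.
(* The empty set is there to be the union of the empty chain. *)
have [F F_P F_tot|J [[->|[Jid Ja J1]] Jmax]] :=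
    @Zorn_bigcup A (fun J => J = set0 \/ proper J).
- have [[J FJ [b Jb]]|F0] := pselect (exists2 J, F J & J !=set0)%classic; last first.
    left; apply/seteqP; split=> // b [J FJ Jb]; apply: F0; exists J => //.
    by exists b.
  have ne K c : F K -> K c -> proper K.
    by move=> /F_P[-> //|].
  have [[J0 _ _] Ja _] := ne J b FJ Jb.
  right; split; [split| |].
  + by exists J.
  + move=> c d [K FK Kc] [L FL Ld]; have [KL|LK] := F_tot K L FK FL.
      by exists L => //; have [[_ LD _] _ _] := ne L d FL Ld; apply: LD => //; apply: KL.
    by exists K => //; have [[_ KD _] _ _] := ne K c FK Kc; apply: KD => //; apply: LK.
  + move=> c d [K FK Kc]; exists K => //.
    by have [[_ _ KM] _ _] := ne K c FK Kc; apply: KM.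
  + by exists J.
  + by move=> [K FK K1]; have [_ _ []] := ne K 1 FK K1.
- case: (Jmax [set c | exists b, c = a * b]%classic); last first.
    right; split; first split.
    + by exists 0; rewrite mulr0.
    + by move=> _ _ [b ->] [c ->]; exists (b + c); rewrite mulrDr.
    + by move=> _ c [b ->]; exists (b * c); rewrite mulrA.
    + by exists 1; rewrite mulr1.
    + by move=> [b /esym/eqP]; apply/negP.
  by split=> [|/(_ 0)]; [exact: sub0set|apply; exists 0; rewrite mulr0].
- exists J => //; split=> //; first by apply/eqP => JT; apply: J1; rewrite JT.
  move=> K Kid JK /eqP K_neqT; apply/esym/seteqP; split=> //; apply: contrapT => KJ.
  case: (Jmax K) => //; right; split=> //; first exact: JK.
  by move=> /(full _ Kid).
Qed.

Lemma local_right_unit I a : local_ring A -> maximal_right_ideal I -> ~ I a ->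
  exists b, a * b = 1.
Proof.
move=> [M [_ Muniq]] Imax Ia; apply: contrapT => a_ninv.
have [b|J Jmax Ja] := @maximal_right_ideal_over a.
  by apply/eqP => ab; apply: a_ninv; exists b.
by apply: Ia; rewrite -(Muniq I Imax) (Muniq J Jmax).
Qed.

End LocalRing.

Lemma const_termC (k : fieldType) (x : k) : const_term (x%:A : ncser k) = x.
Proof. by rewrite /const_term coefA. Qed.

Lemma const_term1 (k : fieldType) : const_term (1 : ncser k) = 1.
Proof. by rewrite -(scale1r (1 : ncser k)) const_termC. Qed.

(** The series without constant term form a maximal right ideal, of codimension 1
    over k; in a local ring it is the only one. *)
Lemma local_series_right_unit (k : fieldType) (P : {pred ncser k})
    (P_alg : subalg_closed P) (r : ncser k) :
  local_ring (subring (GRing.subalg_closedBM P_alg)) ->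
  r \in P -> const_term r != 0 -> exists2 s, s \in P & r * s = 1.
Proof.
set P_ring := GRing.subalg_closedBM P_alg => loc Pr r0.
pose aug (s : subring P_ring) := const_term (subring_val s) = 0.
have augE s : aug s <-> const_term (subring_val s) = 0 by [].
have [P1 PZ PM] := P_alg.
have const_inv (s : subring P_ring) : const_term (subring_val s) != 0 ->
    exists t c : subring P_ring, aug t /\ s * c + t = 1.
  move=> s0; pose x := (const_term (subring_val s))^-1.
  have PC : x%:A \in subring_pred P_ring.
    have P0 : 0 \in P by have := PZ (-1) 1 1 P1 P1; rewrite scaleN1r addNr.
    by have := PZ x 1 0 P1 P0; rewrite addr0.
  exists (1 - s * Subring PC), (Subring PC); split; last by rewrite addrC subrK.
  rewrite augE -[LHS]/(const_term 1 - const_term (subring_val s * x%:A)).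
  by rewrite const_termM const_termC const_term1 divff // subrr.
have aug_max : maximal_right_ideal aug.
  split; first split.
  - by rewrite augE; apply: coef0.
  - by move=> s t; rewrite !augE const_termD => -> ->; rewrite addr0.
  - by move=> s t; rewrite !augE const_termM => ->; rewrite mul0r.
  - apply/eqP => augT; have : aug 1 by rewrite augT.
    by rewrite augE => /eqP; rewrite oner_eq0.
  move=> J [J0 JD JM] augJ J_neqT; apply/seteqP; split=> // s Js.
  have [//|/const_inv[t [c [/augJ Jt sct]]]] := eqVneq (const_term (subring_val s)) 0.
  case/eqP: J_neqT; apply/seteqP; split=> // d _; rewrite -[d]mul1r -sct.
  by apply/JM/JD => //; apply: JM.
have [|[s Ps] rs] :=
    @local_right_unit _ aug (Subring (Pr : r \in subring_pred P_ring)) loc aug_max.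
  by rewrite augE; apply/eqP.
by exists s => //; have := congr1 (@subring_val _ _ _) rs.
Qed.

(** * Idempotents in the subgroup generated by the class of the ring *)
Section CyclicClasses.
Variable A : nzRingType.
Implicit Types e : A.

Lemma cyclic_class_sub e (x y : A) : e * e = e -> x * y = 1 -> e * y = y -> x * e = x ->
  cyclic_class e -> cyclic_class (e - y * x).
Proof.
move=> ee xy ey xe [m mE]; exists (m - 1).
have ff : y * x * (y * x) = y * x by rewrite mulrA -(mulrA y) xy mulr1.
have ef : e * (y * x) = y * x by rewrite mulrA ey.
have fe : y * x * e = y * x by rewrite -mulrA xe.
have gf : (e - y * x) * (y * x) = 0 by rewrite mulrBl ef ff subrr.
have fg : y * x * (e - y * x) = 0 by rewrite mulrBr fe ff subrr.
have gg : (e - y * x) * (e - y * x) = e - y * x by rewrite [LHS]mulrBr gf subr0 mulrBl ee fe.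
have := idem_classD gg ff gf fg; rewrite subrK => eE.
have fE : idem_class (y * x) = iso_class (fgfree A^c 1).
  by rewrite -idem_class1; apply: (idem_class_equiv (a := y) (b := x)) => //; rewrite mulr1.
by move: mE; rewrite eE groth_ofD fE mulrzBr mulr1z -/(K0_unit A) => <-; rewrite addrK.
Qed.

(** The n orthogonal idempotents y_i x_i all have the class of 1, so the class is
    (1 - n) [A]. *)
Lemma cyclic_class_cuntz (x y : nat -> A) n :
  (forall i j, x i * y j = (i == j)%:R) -> cyclic_class (1 - \sum_(i < n) y i * x i).
Proof.
move=> xy; elim: n => [|n IH].
  by rewrite big_ord0 subr0; exists 1; rewrite mulr1z idem_class1.
have eyn : (\sum_(i < n) y i * x i) * y n = 0.
  rewrite mulr_suml big1 // => i _.
  by rewrite -mulrA xy ltn_eqF ?mulr0.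
have xen : x n * (\sum_(i < n) y i * x i) = 0.
  rewrite mulr_sumr big1 // => i _.
  by rewrite mulrA xy gtn_eqF ?mul0r.
have ff : (\sum_(i < n) y i * x i) * (\sum_(i < n) y i * x i) = \sum_(i < n) y i * x i.
  rewrite mulr_sumr; apply: eq_bigr => i _; rewrite mulr_suml (bigD1 i) //=.
  rewrite big1 ?addr0 => [|j /negPf ji].
    by rewrite mulrA -(mulrA (y i)) xy eqxx mulr1.
  by rewrite mulrA -(mulrA (y j)) xy val_eqE ji mulr0 mul0r.
rewrite big_ord_recr /= opprD addrA; apply: cyclic_class_sub => //.
- by rewrite mulrBl mul1r mulrBr mulr1 ff subrr subr0.
- by rewrite xy eqxx.
- by rewrite mulrBl mul1r eyn subr0.
- by rewrite mulrBr mulr1 xen subr0.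
Qed.

Variables (P : {pred A}) (P_ring : subring_closed P).

(** [cyclic_regular] in a subring, as a condition on elements of the ambient ring,
    in which the computations are carried out. *)
Definition subring_cyclic a := forall Pa : a \in subring_pred P_ring,
  cyclic_regular (Subring Pa).

Lemma subring_cyclic0 : subring_cyclic 0.
Proof.
move=> P0; have -> : Subring P0 = 0 by apply: val_inj.
exact: cyclic_regular0.
Qed.

Lemma subring_cyclic_step a beta gamma p (Pp : p \in subring_pred P_ring) :
    cyclic_class (Subring Pp) -> beta \in P -> gamma \in P ->
    p * p = p -> beta * a * gamma = p -> p * beta = beta ->
  subring_cyclic (a - a * (gamma * beta) * a) -> subring_cyclic a.
Proof.
move=> pm Pb Pg pp bac pb reg Pa; pose b := Subring (Pb : beta \in subring_pred P_ring).
pose c := Subring (Pg : gamma \in subring_pred P_ring).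
apply: (@cyclic_regular_step _ (Subring Pa) b c (Subring Pp)) => //; try exact: val_inj.
have := valP (Subring Pa - Subring Pa * (c * b) * Subring Pa) => /= Pa'.
have -> : Subring Pa - Subring Pa * (c * b) * Subring Pa = Subring Pa' by apply: val_inj.
exact: reg.
Qed.

End CyclicClasses.

(** * Index of the identity plus an operator of finite rank *)

(** The operator H v = v - sum_j phi_j(v) f_j has index 0: its kernel and cokernel
    are isomorphic to those of the D x D matrix 1 - G, where G_ij = phi_j(f_i).  If the kernel is
    contained in a line and N independent forms lam_i vanish on the image, then
    N <= 1. *)
Lemma finite_rank_index (k : fieldType) (V : lmodType k) D N
    (phi : 'I_D -> {scalar V}) (f : 'I_D -> V) (z : V)
    (lam : 'I_N -> {scalar V}) (r : 'I_N -> V) :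
  (forall v, v = \sum_j phi j v *: f j -> exists c, v = c *: z) ->
  (forall i v, lam i v = \sum_j phi j v * lam i (f j)) ->
  (forall i j, lam i (r j) = (i == j)%:R) -> (N <= 1)%N.
Proof.
move=> ker_z lamE lam_r.
pose G : 'M[k]_D := \matrix_(i, j) phi j (f i).
pose L : 'M[k]_(D, N) := \matrix_(j, i) lam i (f j).
pose Phi : 'M[k]_(N, D) := \matrix_(i, j) phi j (r i).
have PhiL : Phi *m L = 1%:M.
  apply/matrixP => i j; rewrite !mxE eq_sym -lam_r lamE.
  by apply: eq_bigr => l _; rewrite !mxE.
have GL : (1%:M - G) *m L = 0.
  apply/eqP; rewrite mulmxBl mul1mx subr_eq0; apply/eqP/matrixP => i j.
  by rewrite !mxE lamE; apply: eq_bigr => l _; rewrite !mxE.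
have kerG : (kermx (1%:M - G) <= \row_j phi j z)%MS.
  apply/rV_subP => x /sub_kermxP; rewrite mulmxBr mulmx1 => /eqP.
  rewrite subr_eq0 => /eqP xG; pose v := \sum_i x 0 i *: f i.
  have phiv j : phi j v = x 0 j.
    rewrite xG mxE raddf_sum; apply: eq_bigr => i _.
    by rewrite /= scalarZ mxE.
  have [|c vE] := ker_z v.
    by rewrite {1}/v; apply: eq_bigr => j _; rewrite phiv.
  apply/sub_rVP; exists c; apply/rowP => j.
  by rewrite !mxE -phiv vE scalarZ.
have := mxrankS kerG; rewrite mxrank_ker => /leq_trans/(_ (rank_leq_row _)).
have := mulmx0_rank_max GL; have := mxrankM_maxr Phi L; rewrite PhiL mxrank1.
rewrite leq_subLR => NL GLD D1; rewrite -(leq_add2l (\rank (1%:M - G))).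
by apply: leq_trans D1; apply: leq_trans GLD; rewrite leq_add2l.
Qed.

(** * Derivatives of series *)
Section Series.
Variable k : fieldType.
Implicit Types (r s : ncser k) (u v w : seq nat).

(** The effect of y_u on series from the right: the last letters are removed,
    following the letters of u from left to right. *)
Fixpoint delw r u : ncser k := if u is i :: u' then delw (delta i r) u' else r.

Lemma coef_delw r u w : coef (delw r u) w = coef r (w ++ rev u).
Proof.
elim: u r => [|i u IH] r /=; first by rewrite cats0.
by rewrite IH /= rev_cons -rcons_cat.
Qed.

Lemma const_delw r u : const_term (delw r u) = coef r (rev u).
Proof. exact: coef_delw. Qed.

Lemma delwZ (x : k) r u : delw (x *: r) u = x *: delw r u.
Proof. by apply/ncserP => w; rewrite coef_delw /= coef_delw. Qed.

(** The components r_i of r = tau(r) + sum_i x_i r_i. *)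
Definition lder i r : ncser k := NCSer (fun w => coef r (i :: w)).

Lemma lderP r s : const_term r = const_term s -> (forall i, lder i r = lder i s) -> r = s.
Proof. by move=> rs lrs; apply/ncserP => -[|i w] //; have /ncserP/(_ w) := lrs i. Qed.

Lemma lderM i r s : lder i (r * s) = const_term r *: lder i s + lder i r * s.
Proof. by apply/ncserP => w; rewrite coefD /= big_ord_recl. Qed.

Lemma const_term_sum I (P : seq I) (F : I -> ncser k) :
  const_term (\sum_(i <- P) F i) = \sum_(i <- P) const_term (F i).
Proof. by apply: (big_morph _ (@const_termD k)); apply: coef0. Qed.

Lemma lder_sum i I (P : seq I) (F : I -> ncser k) :
  lder i (\sum_(j <- P) F j) = \sum_(j <- P) lder i (F j).
Proof.
by apply: (big_morph (lder i)) => [r s|]; apply/ncserP => w //; rewrite coef0 /= mul0rn.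
Qed.

Definition xser i : ncser k := NCSer (fun w => (w == [:: i])%:R).

Lemma const_xser i : const_term (xser i) = 0. Proof. by []. Qed.

Lemma delta_xser i j : delta j (xser i) = (i == j)%:R.
Proof.
apply/ncserP => w; have -> : (i == j)%:R = (i == j)%:R%:A :> ncser k.
  by case: eqP; rewrite ?scale1r ?scale0r.
rewrite coefA /delta /=; case: w => [|l w] /=; last first.
  by rewrite eqseq_cons; case: w => [|? ?]; rewrite /= andbF mulr0n.
by rewrite eqseq_cons andbT eq_sym mulr1n.
Qed.

Lemma delta_seriesP r s : const_term r = const_term s ->
  (forall i, delta i r = delta i s) -> r = s.
Proof.
by move=> rs drs; apply/ncserP; case/lastP => [//|w i]; have /ncserP/(_ w) := drs i.
Qed.

Variable n : nat.

Lemma delta_out i r : r \in series_in n -> (n < i)%N -> delta i r = 0.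
Proof.
move=> /asboolP rn ni; apply/ncserP => w; rewrite coef0.
have [//|/rn] := eqVneq (coef r (rcons w i)) 0.
by rewrite all_rcons leqNgt ni.
Qed.

Lemma series_inE r : r \in series_in n ->
  r = (const_term r)%:A + \sum_(i < n.+1) delta i r * xser i.
Proof.
move=> rn; apply: delta_seriesP => [|j].
  rewrite const_termD const_termC const_term_sum big1 ?addr0 // => i _.
  by rewrite const_termM mulr0.
rewrite deltaD deltaC add0r (big_morph _ (@deltaD k j) (delta0 k j)).
have term i : delta j (delta i r * xser i) = delta i r *+ (i == j).
  rewrite deltaM const_xser scale0r mulr0 add0r delta_xser.
  by case: eqP => _; rewrite ?mulr1 ?mulr0.
under eq_bigr => i _ do rewrite term.
have [jn|nj] := ltnP j n.+1; last first.
  rewrite delta_out // big1 // => i _.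
  by case: eqP => // ij; move: nj; rewrite -ij leqNgt ltn_ord.
rewrite (bigD1 (Ordinal jn)) //= eqxx mulr1n big1 ?addr0 // => i.
by rewrite -val_eqE /= => /negPf->.
Qed.

End Series.

Lemma min_order (k : fieldType) (I : eqType) (F : seq I) (r : I -> ncser k) :
  (exists2 v, v \in F & r v != 0) -> exists v w,
  [/\ v \in F, coef (r v) w != 0 &
      forall v' w', v' \in F -> (size w' < size w)%N -> coef (r v') w' = 0].
Proof.
move=> [v vF rv]; pose Q d := `[< exists v w, [/\ v \in F, coef (r v) w != 0 & size w = d] >].
have ex : exists d, Q d.
  have [w cw] : exists w, coef (r v) w != 0.
    apply: contrapT => rv0; case/eqP: rv; apply/ncserP => w; rewrite coef0.
    by apply/eqP/negPn/negP => cw; apply: rv0; exists w.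
  by exists (size w); apply/asboolP; exists v, w.
case: (ex_minnP ex) => d /asboolP[v1 [w [v1F cw wd]]] dmin; exists v1, w; split=> // v' w' v'F.
apply: contraTeq => cw'; rewrite -leqNgt wd; apply: dmin; apply/asboolP.
by exists v', w'.
Qed.

(** * The two actions of the skew ring on series *)

(** The ring S = k<<X>><Y; tau, delta> enters through its defining relations and
    its basis: [ofser] embeds the series, [ymon u] is y_u, and [cf u a] is the
    coefficient of a at y_u, nonzero exactly for u in [supp a]. *)
Section SkewPresentation.
Variables (k : fieldType) (S : nzRingType).
Variables (ofser : {rmorphism ncser k -> S}) (ymon : seq nat -> S).
Variables (cf : seq nat -> {additive S -> ncser k}) (supp : S -> seq (seq nat)).
Hypothesis ymon0 : ymon [::] = 1.
Hypothesis ymonM : forall u v, ymon u * ymon v = ymon (u ++ v).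
Hypothesis ofser_y : forall r i, ofser r * ymon [:: i] =
  ymon [:: i] * ofser (const_term r)%:A + ofser (delta i r).
Hypothesis cf_ymon : forall u r v, cf v (ymon u * ofser r) = r *+ (u == v).
Hypothesis supp_cf : forall a u, (u \in supp a) = (cf u a != 0).
Hypothesis supp_sum : forall a, a = \sum_(u <- supp a) ymon u * ofser (cf u a).
Implicit Types (r s : ncser k) (u v w : seq nat) (a b c : S).

Lemma ymonS i u : ymon (i :: u) = ymon [:: i] * ymon u.
Proof. by rewrite ymonM. Qed.

Lemma cf_ofser r : cf [::] (ofser r) = r.
Proof. by rewrite -[ofser r]mul1r -ymon0 cf_ymon. Qed.

Lemma cf_nil_yM i u b : cf [::] (ymon (i :: u) * b) = 0.
Proof.
rewrite (supp_sum b) mulr_sumr raddf_sum big1 // => w _.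
by rewrite /= mulrA ymonM cf_ymon.
Qed.

(** As sum_i y_i S is a right ideal and S is its direct sum with the series, S acts
    on the series from the right; y_i acts as delta_i, and a series by
    multiplication. *)
Definition ract r a : ncser k := cf [::] (ofser r * a).

Lemma ract0l a : ract 0 a = 0.
Proof. by rewrite /ract rmorph0 mul0r raddf0. Qed.

Lemma ract0 r : ract r 0 = 0. Proof. by rewrite /ract mulr0 raddf0. Qed.

Lemma ract_of r s : ract r (ofser s) = r * s.
Proof. by rewrite /ract -rmorphM cf_ofser. Qed.

Lemma ract1 r : ract r 1 = r. Proof. by rewrite /ract mulr1 cf_ofser. Qed.

Lemma ractDl r s a : ract (r + s) a = ract r a + ract s a.
Proof. by rewrite /ract rmorphD mulrDl raddfD. Qed.

Lemma ract_sumr r I (P : seq I) (F : I -> S) :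
  ract r (\sum_(i <- P) F i) = \sum_(i <- P) ract r (F i).
Proof. by rewrite /ract mulr_sumr raddf_sum. Qed.

Lemma cf_nilM a b : cf [::] (a * b) = ract (cf [::] a) b.
Proof.
rewrite {1}(supp_sum a) mulr_suml raddf_sum.
have -> : cf [::] a = \sum_(u <- supp a) cf [::] (ymon u * ofser (cf u a)).
  by rewrite {1}(supp_sum a) raddf_sum.
rewrite (big_morph (fun r => ract r b) (fun r s => ractDl r s b) (ract0l b)).
apply: eq_bigr => -[|i u] _ /=; first by rewrite ymon0 mul1r cf_ofser.
by rewrite -mulrA !cf_nil_yM ract0l.
Qed.

Lemma ractM r a b : ract (ract r a) b = ract r (a * b).
Proof. by rewrite -cf_nilM /ract mulrA. Qed.

Lemma ract_ymon r u : ract r (ymon u) = delw r u.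
Proof.
elim: u r => [|i u IH] r; first by rewrite ymon0 ract1.
rewrite ymonS -ractM IH /=; congr delw.
by rewrite /ract ofser_y raddfD /= cf_nil_yM add0r cf_ofser.
Qed.

Lemma ractE r a : ract r a = \sum_(u <- supp a) delw r u * (cf u a).
Proof.
rewrite [in LHS](supp_sum a) ract_sumr; apply: eq_bigr => u _.
by rewrite -ractM ract_ymon ract_of.
Qed.

Lemma ractZl (x : k) r a : ract (x *: r) a = x *: ract r a.
Proof.
by rewrite !ractE scaler_sumr; apply: eq_bigr => u _; rewrite delwZ scalerAl.
Qed.

Lemma ract_suml I (P : seq I) (F : I -> ncser k) a :
  ract (\sum_(i <- P) F i) a = \sum_(i <- P) ract (F i) a.
Proof.
by apply: (big_morph (fun r => ract r a)) => [r s|]; rewrite ?ractDl // ract0l.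
Qed.

(** The second action: a acts on the components [lder i r] by the first action and
    the constant term is sent to 0 ([const_term_ract_red] and [lder_ract_red]).
    This definition exhibits the difference of the two actions as an operator of
    finite rank. *)
Definition ract_red r a : ncser k :=
  ract r a - \sum_(u <- supp a) coef r (rev u) *: cf u a.

Lemma ract_redE r a : ract_red r a =
  \sum_(u <- supp a) (delw r u - (coef r (rev u))%:A) * (cf u a).
Proof.
rewrite /ract_red ractE -sumrB; apply: eq_bigr => u _.
by rewrite mulrBl mulr_algl.
Qed.

Let const_red r u : const_term (delw r u - (coef r (rev u))%:A) = 0.
Proof. by rewrite const_termD const_delw [X in _ + X]coefN coefA eqxx mulr1n subrr. Qed.

Lemma const_term_ract_red r a : const_term (ract_red r a) = 0.
Proof.
rewrite ract_redE const_term_sum big1 // => u _.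
by rewrite const_termM const_red mul0r.
Qed.

(** Removing the first letter commutes with removing letters at the end, and
    lder (f s) = tau(f) lder s + (lder f) s.  Subtracting tau(f) from each
    f = delw r u removes the first summand. *)
Lemma lder_ract_red i r a : lder i (ract_red r a) = ract (lder i r) a.
Proof.
rewrite ract_redE lder_sum ractE; apply: eq_bigr => u _.
rewrite lderM const_red scale0r add0r; congr (_ * _); apply/ncserP => w.
by rewrite coef_delw /= coef_delw /= mulr0n mulr0 subr0.
Qed.

Lemma ract_redM r a b : ract_red (ract_red r a) b = ract_red r (a * b).
Proof.
apply: lderP => [|i]; first by rewrite !const_term_ract_red.
by rewrite !lder_ract_red ractM.
Qed.

Lemma ract_red1 r : ract_red r 1 = r - (const_term r)%:A.
Proof.
apply: lderP => [|i].
  by rewrite const_term_ract_red const_termD [X in _ + X]coefN coefA subrr.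
rewrite lder_ract_red ract1; apply/ncserP => w.
by rewrite /= mulr0n mulr0 subr0.
Qed.

Lemma ract_red_sumr r I (P : seq I) (F : I -> S) :
  ract_red r (\sum_(i <- P) F i) = \sum_(i <- P) ract_red r (F i).
Proof.
apply: lderP => [|i].
  rewrite const_term_ract_red const_term_sum big1 // => i _.
  exact: const_term_ract_red.
by rewrite lder_ract_red lder_sum ract_sumr; apply: eq_bigr => j _; rewrite lder_ract_red.
Qed.

Lemma ract_red0l a : ract_red 0 a = 0.
Proof.
have lder0 i : lder i (0 : ncser k) = 0.
  by apply/ncserP => w; rewrite coef0 /= mul0rn.
apply: lderP => [|i]; first by rewrite const_term_ract_red; apply/esym/coef0.
by rewrite lder_ract_red lder0 ract0l.
Qed.

Lemma ract_ract_red r a b : ract (ract_red r a) b =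
  ract r (a * b) - \sum_(u <- supp a) coef r (rev u) *: ract (cf u a) b.
Proof.
rewrite /ract_red -scaleN1r ractDl ractZl scaleN1r ractM; congr (_ - _).
by rewrite ract_suml; apply: eq_bigr => u _; rewrite ractZl.
Qed.

(** * Rank one from the Cuntz relations *)
Section Cuntz.
Variables (n : nat) (xi eta : 'I_n.+1 -> S).
Hypothesis xieta : forall i j, xi i * eta j = (i == j)%:R.
Hypothesis etaxi : \sum_i eta i * xi i = 1.

(** H r = r - sum_j phi_j(r) f_j, where j runs over the pairs of an index i and a
    word u in the support of eta_i. *)
Let s := [seq (rev u, ract (cf u (eta i)) (xi i)) |
           i <- index_enum 'I_n.+1, u <- supp (eta i)].
Let phi (j : 'I_(size s)) r := coef r (tnth (in_tuple s) j).1.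
Let f (j : 'I_(size s)) := (tnth (in_tuple s) j).2.

Let phi_lin j : scalar (phi j). Proof. by []. Qed.
Let phiL j : {scalar ncser k} :=
  HB.pack (phi j) (GRing.isLinear.Build _ _ _ _ _ (phi_lin j)).

Let lam (i : 'I_n.+1) r := const_term (ract r (eta i)).
Let lam_lin i : scalar (lam i).
Proof. by move=> c r t; rewrite /lam ractDl ractZl const_termD. Qed.
Let lamL i : {scalar ncser k} :=
  HB.pack (lam i) (GRing.isLinear.Build _ _ _ _ _ (lam_lin i)).

(** The mixed operator H: the second action on the inside, the first one on the
    outside.  The forms [lam] vanish on its image. *)
Let H r := \sum_i ract (ract_red r (eta i)) (xi i).

Let HE r : H r = r - \sum_j phi j r *: f j.
Proof.
have -> : \sum_j phi j r *: f j = \sum_(p <- s) coef r p.1 *: p.2.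
  by rewrite [RHS]big_tnth.
rewrite /s big_allpairs_dep /= -[X in _ = X - _](ract1 r) -etaxi ract_sumr -sumrB.
apply: eq_bigr => i _; exact: ract_ract_red.
Qed.

Let Heta r j : ract (H r) (eta j) = ract_red r (eta j).
Proof.
rewrite /H ract_suml (bigD1 j) //= ractM xieta eqxx ract1 big1 ?addr0 // => i ij.
by rewrite ractM xieta (negPf ij) ract0.
Qed.

(** On the kernel of H all the elements eta_i act as 0 by the second action, hence so
    does 1 = sum_i eta_i xi_i, and the kernel consists of constants.  The n + 1 forms
    r |-> tau(r eta_i) vanish on the image and are dual to the series 1 xi_j. *)
Lemma skew_cuntz_rank1 : n = 0%N.
Proof.
suff: (n.+1 <= 1)%N by case: (n).
apply: (@finite_rank_index k (ncser k) _ _ phiL f 1 lamL (fun j => ract 1 (xi j))).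
- move=> r rE; have Hr : H r = 0 by rewrite HE {1}rE subrr.
  exists (const_term r); apply/eqP; rewrite -subr_eq0 -ract_red1 -etaxi ract_red_sumr.
  by rewrite big1 // => i _; rewrite -ract_redM -Heta Hr ract0l ract_red0l.
- move=> i r /=; apply/eqP; rewrite -subr_eq0 -[X in _ - X]/(\sum_j phi j r * lam i (f j)).
  have -> : \sum_j phi j r * lam i (f j) = lamL i (\sum_j phi j r *: f j).
    by rewrite raddf_sum; apply: eq_bigr => j _; apply/esym/(scalarZ (lamL i)).
  by rewrite -[lam i r]/(lamL i r) -raddfB -HE /= /lam Heta const_term_ract_red.
- move=> i j /=; rewrite /lam ractM xieta eq_sym; case: eqP => _.
    by rewrite ract1.
  by rewrite ract0; apply: coef0.
Qed.

End Cuntz.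

(** * The idempotents e_n *)
Definition skx i : S := ofser (xser k i).
Local Notation sky i := (ymon [:: (i : nat)]).

Lemma skx_ymon i j : skx i * sky j = (i == j)%:R.
Proof.
rewrite ofser_y const_xser scale0r rmorph0 mulr0 add0r delta_xser.
by case: eqP => _; rewrite ?rmorph0 ?rmorph1.
Qed.

Lemma ofser_algC (x : k) a : ofser x%:A * a = a * ofser x%:A.
Proof.
have yC u : ofser x%:A * ymon u = ymon u * ofser x%:A.
  elim: u => [|i u IH]; first by rewrite ymon0 mulr1 mul1r.
  by rewrite ymonS mulrA ofser_y deltaC rmorph0 addr0 const_termC -mulrA IH mulrA.
rewrite [in LHS](supp_sum a) [in RHS](supp_sum a) mulr_sumr mulr_suml.
apply: eq_bigr => u _; rewrite mulrA yC -!mulrA -!rmorphM.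
by rewrite mulr_algl mulr_algr.
Qed.

(** The word dual to y_v: the letters of v are in reverse order. *)
Fixpoint skX v : S := if v is i :: v' then skX v' * skx i else 1.

Lemma skX_rcons v i : skX (rcons v i) = skx i * skX v.
Proof. by elim: v => [|j v IH] /=; rewrite ?mul1r ?mulr1 // IH mulrA. Qed.

Lemma skX_ymon_cons i v j u :
  skX (i :: v) * ymon (j :: u) = (skX v * ymon u) *+ (i == j).
Proof.
rewrite ymonS /= mulrA -(mulrA _ (skx i)) skx_ymon; case: eqP => _.
  by rewrite mulr1 mulr1n.
by rewrite mulr0 mul0r mulr0n.
Qed.

Lemma skX_ymon_ser v u : (size u <= size v)%N -> exists r, skX v * ymon u = ofser r.
Proof.
elim: v u => [|i v IH] [|j u] //=; first by exists 1; rewrite ymon0 mulr1 rmorph1.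
  have [//|r] := IH [::]; rewrite ymon0 !mulr1 => -> _; exists (r * xser k i).
  by rewrite rmorphM.
move=> /IH[r rE]; exists (r *+ (i == j)); rewrite skX_ymon_cons rE.
by case: (i =P j) => _ /=; rewrite ?mulr0n ?mulr1n ?rmorph0.
Qed.

Lemma skX_ymon v u : size v = size u -> skX v * ymon u = (v == u)%:R.
Proof.
elim: v u => [|i v IH] [|j u] //=; first by rewrite ymon0 mulr1.
move=> [/IH vu]; rewrite skX_ymon_cons vu eqseq_cons.
by case: (i =P j) => _ /=; rewrite ?mulr0n ?mulr1n.
Qed.

Lemma ofser_ymon r u : (forall w, (size w < size u)%N -> coef r w = 0) ->
  ofser r * ymon u = ofser (delw r u).
Proof.
elim: u r => [|i u IH] r r0; first by rewrite ymon0 mulr1.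
have c0 : const_term r = 0 by apply: r0.
rewrite ymonS mulrA ofser_y c0 scale0r rmorph0 mulr0 add0r IH // => w wu.
by apply: r0; rewrite size_rcons.
Qed.

Variable n : nat.
Local Notation inY := (all (fun i => (i <= n)%N)).

Definition ske : S := 1 - \sum_(i < n.+1) sky i * skx i.

Lemma ske_ymon i : (i <= n)%N -> ske * sky i = 0.
Proof.
move=> i_n; rewrite mulrBl mul1r mulr_suml (bigD1 (Ordinal (i_n : i < n.+1)%N)) //=.
rewrite -mulrA skx_ymon eqxx mulr1 big1 ?addr0 ?subrr // => j.
by rewrite -val_eqE /= -mulrA skx_ymon => /negPf->; rewrite mulr0.
Qed.

Lemma skx_ske i : (i <= n)%N -> skx i * ske = 0.
Proof.
move=> i_n; rewrite mulrBr mulr1 mulr_sumr (bigD1 (Ordinal (i_n : i < n.+1)%N)) //=.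
rewrite mulrA skx_ymon eqxx mul1r big1 ?addr0 ?subrr // => j.
by rewrite -val_eqE /= mulrA skx_ymon eq_sym => /negPf->; rewrite mul0r.
Qed.

Lemma ser_ske r : r \in series_in n -> ofser r * ske = ofser (const_term r)%:A * ske.
Proof.
move=> rn; rewrite [in LHS](series_inE rn) rmorphD mulrDl rmorph_sum mulr_suml.
by rewrite big1 ?addr0 // => i _; rewrite rmorphM -mulrA skx_ske ?mulr0 // -ltnS.
Qed.

Lemma ske_idem : ske * ske = ske.
Proof.
rewrite {2}/ske mulrBr mulr1 mulr_sumr big1 ?subr0 // => i _.
by rewrite mulrA ske_ymon ?mul0r // -ltnS.
Qed.

Lemma mul_kill_ymon z a : (forall i, (i <= n)%N -> z * sky i = 0) ->
  (forall u, (cf u a) != 0 -> inY u) -> z * a = z * ofser (cf [::] a).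
Proof.
move=> zy aY; rewrite [in LHS](supp_sum a) mulr_sumr.
have -> : (cf [::] a) = \sum_(u <- supp a) cf [::] (ymon u * ofser (cf u a)).
  by rewrite {1}(supp_sum a) raddf_sum.
rewrite rmorph_sum mulr_sumr; apply: eq_big_seq => u.
rewrite supp_cf => /aY; case: u => [|i u] /=.
  by rewrite ymon0 mul1r cf_ofser.
case/andP=> i_n _; rewrite ymonS -mulrA [in LHS]mulrA zy // mul0r.
by rewrite mulrA -ymonS cf_nil_yM rmorph0 mulr0.
Qed.

Lemma ske_ser_ymon r u : inY u -> ske * (ofser r * ymon u) = ske * ofser (delw r u).
Proof.
elim: u r => [|i u IH] r /=; first by rewrite ymon0 mulr1.
case/andP=> i_n uY; rewrite ymonS (mulrA (ofser r)) ofser_y (mulrDl (sky i * _)) (mulrDr ske).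
by rewrite IH // !(mulrA ske) ske_ymon // !mul0r add0r.
Qed.

Lemma skX_ymon_ske v u : inY v -> inY u -> (size u <= size v)%N ->
  skX v * (ymon u * ske) = ske *+ (v == u).
Proof.
elim: v u => [|i v IH] [|j u] //=; first by rewrite ymon0 !mul1r.
  by case/andP=> i_n _ _ _; rewrite ymon0 mul1r -mulrA skx_ske ?mulr0 // mulr0n.
case/andP=> i_n vY /andP[j_n uY]; rewrite ltnS => /(IH _ vY uY) vu.
rewrite mulrA skX_ymon_cons eqseq_cons.
by case: (i =P j) => _ /=; rewrite ?mulr0n ?mul0r // mulr1n -mulrA vu.
Qed.

Lemma ske_skX_ymon_ske v u : inY v -> inY u ->
  ske * (skX v * (ymon u * ske)) = ske *+ (v == u).
Proof.
elim: v u => [|i v IH] [|j u] //=; first by rewrite ymon0 !mul1r ske_idem.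
- by move=> _ /andP[j_n _]; rewrite mul1r ymonS -mulrA mulrA ske_ymon // mul0r.
- by case/andP=> i_n _ _; rewrite ymon0 mul1r -mulrA skx_ske ?mulr0 // mulr0n.
case/andP=> i_n vY /andP[j_n uY].
rewrite (mulrA _ _ ske) skX_ymon_cons eqseq_cons.
case: (i =P j) => _; rewrite ?mulr0n ?mul0r ?mulr0 // mulr1n -(mulrA _ _ ske).
exact: IH.
Qed.

(** * A partition of unity *)
Fixpoint words m : seq (seq nat) :=
  if m is m'.+1 then [seq rcons w i | w <- words m', i <- iota 0 n.+1] else [:: [::]].

Fixpoint short_words m : seq (seq nat) :=
  if m is m'.+1 then short_words m' ++ words m' else [::].

Lemma wordsP m w : w \in words m -> size w = m /\ inY w.
Proof.
elim: m w => [|m IH] w; first by rewrite inE => /eqP ->.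
case/allpairsP => -[v i] [/IH[vm vY]]; rewrite mem_iota add0n ltnS => i_n ->.
by rewrite /= size_rcons all_rcons vm vY andbT.
Qed.

Lemma words_uniq m : uniq (words m).
Proof.
elim: m => [//|m IH]; apply: allpairs_uniq => //; first exact: iota_uniq.
by move=> [v i] [w j] _ _ /= /rcons_inj[-> ->].
Qed.

Lemma short_wordsP m w : w \in short_words m -> (size w < m)%N /\ inY w.
Proof.
elim: m => [//|m IH]; rewrite mem_cat => /orP[/IH[wm ->]|/wordsP[-> ->]] //.
by split=> //; apply: ltnW.
Qed.

Lemma short_words_uniq m : uniq (short_words m).
Proof.
elim: m => [//|m IH]; rewrite cat_uniq IH words_uniq andbT /=.
by apply/hasPn => w /wordsP[wm _]; apply/negP => /short_wordsP[]; rewrite wm ltnn.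
Qed.

(** Each induction step inserts 1 = e_n + sum_i y_i x_i between y_v and its dual. *)
Lemma ymonX_partition m : 1 = \sum_(v <- words m) ymon v * skX v +
  \sum_(v <- short_words m) ymon v * (ske * skX v).
Proof.
elim: m => [|m {1}->]; first by rewrite big_seq1 big_nil ymon0 addr0 mul1r.
rewrite -[words m.+1]/[seq rcons w i | w <- words m, i <- iota 0 n.+1].
rewrite -[short_words m.+1]/(short_words m ++ words m) big_cat big_allpairs_dep.
rewrite [X in _ = _ + X]addrC [in RHS]addrA; congr (_ + _).
rewrite -big_split /=; apply: eq_bigr => v _.
have {1}-> : skX v = ske * skX v + \sum_(i < n.+1) sky i * skx i * skX v.
  by rewrite -mulr_suml -mulrDl addrNK mul1r.
rewrite mulrDr addrC mulr_sumr; congr (_ + _).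
rewrite -(big_mkord xpredT (fun i => ymon v * (sky i * skx i * skX v))) /index_iota subn0.
apply: eq_bigr => i _.
by rewrite skX_rcons -cats1 -ymonM !mulrA.
Qed.

Lemma skX_in (P : {pred S}) v : mulr_closed P ->
  (forall i, i \in v -> skx i \in P) -> skX v \in P.
Proof.
case=> P1 PM; elim: v => [|i v IH] //= vP; apply: PM; last by apply: vP; rewrite inE eqxx.
by apply: IH => j jv; apply: vP; rewrite inE jv orbT.
Qed.

(** * Every nonzero element can be multiplied to 1 *)
Lemma delta_series_in i r : r \in series_in n -> delta i r \in series_in n.
Proof.
by move=> /asboolP rn; apply/asboolP => w /rn; rewrite all_rcons => /andP[].
Qed.

Lemma delw_series_in u r : r \in series_in n -> delw r u \in series_in n.
Proof. by elim: u r => [//|i u IH] r /= /(delta_series_in i)/IH. Qed.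

Lemma ske_ser_ymon_ske r u : r \in series_in n -> inY u ->
  ske * ofser r * (ymon u * ske) = ske * ofser (coef r (rev u))%:A.
Proof.
move=> /(delw_series_in u) dr uY.
rewrite -(mulrA ske) (mulrA (ofser r)) mulrA ske_ser_ymon // -mulrA ser_ske //.
by rewrite const_delw ofser_algC mulrA ske_idem.
Qed.

Lemma ske_algM (x y : k) r :
  ske * ofser x%:A * (ofser y%:A * (ske * ofser r)) = ske * ofser ((x * y) *: r).
Proof.
rewrite (mulrA (ofser y%:A)) -ofser_algC (ofser_algC y) -(mulrA (ofser x%:A)).
rewrite -(mulrA ske (ofser y%:A)) (mulrA ske ske) ske_idem mulrA ofser_algC -mulrA.
by congr (_ * _); rewrite -!rmorphM !mulr_algl scalerA.
Qed.

Lemma mul_kill_skX_ymon z v u : (forall i, (i <= n)%N -> z * sky i = 0) -> inY u ->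
  (size v <= size u)%N -> z * (skX v * ymon u) = z *+ (v == u).
Proof.
move=> zy; elim: v u => [|i v IH] [|j u] //=; first by rewrite ymon0 !mulr1.
  by case/andP=> j_n _ _; rewrite mul1r ymonS mulrA zy // mul0r.
case/andP=> j_n uY vu; rewrite skX_ymon_cons eqseq_cons.
by case: (i =P j) => _; rewrite ?mulr0n ?mulr0 // mulr1n IH.
Qed.

(** For v of minimal length in the support of a, the letter x_(n+1) kills all the
    terms of (skX v) a except the series r at v.  With w a shortest word of r,
    r y_(rev w) is a series f with nonzero constant term, and
    f y_(n+1) = y_(n+1) tau(f) because the letter x_(n+1) does not occur in f. *)
Lemma skew_two_sided_inverses a : a != 0 ->
  (forall u, cf u a != 0 -> inY u) -> (forall u, cf u a \in series_in n) ->
  exists v u, exists2 x : k, inY v &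
    skx n.+1 * skX v * a * (ymon u * ymon [:: n.+1] * ofser x%:A) = 1.
Proof.
move=> a0 aY an.
have [v av vmin] : exists2 v, cf v a != 0 &
    forall u, cf u a != 0 -> (size v <= size u)%N.
  have ex : exists d, has (fun u => size u == d) (supp a).
    case E: (supp a) => [|u s]; last by exists (size u); rewrite /= eqxx.
    by case/eqP: a0; rewrite (supp_sum a) E big_nil.
  case: (ex_minnP ex) => d /hasP[v va /eqP <-] dmin; exists v; first by rewrite -supp_cf.
  by move=> u ua; apply: dmin; apply/hasP; exists u; rewrite ?supp_cf.
have Xa : skx n.+1 * skX v * a = skx n.+1 * ofser (cf v a).
  rewrite [in LHS](supp_sum a) [in RHS](supp_sum a) mulr_sumr !raddf_sum mulr_sumr.
  apply: eq_big_seq => u; rewrite supp_cf => ua /=.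
  rewrite cf_ymon mulrA -(mulrA (skx _)) mul_kill_skX_ymon ?vmin ?aY //.
    by rewrite eq_sym; case: eqP => _; rewrite ?mulr1n // !mulr0n mul0r rmorph0 mulr0.
  by move=> i i_n; rewrite skx_ymon gtn_eqF.
have [_ [w [/predU1P[->|//] cw wmin]]] :=
  @min_order k _ [:: v] (cf^~ a) (ex_intro2 _ _ v (mem_head _ _) av).
exists v, (rev w), (coef (cf v a) w)^-1; first exact: aY.
have dn := delw_series_in (rev w) (an v).
rewrite Xa mulrA (mulrA (_ * ofser _)) -(mulrA (skx _)) ofser_ymon; last first.
  by move=> w' ; rewrite size_rev; apply: wmin; rewrite mem_head.
rewrite -(mulrA (skx _)) ofser_y (delta_out dn) // rmorph0 addr0 mulrA skx_ymon eqxx mul1r.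
by rewrite -rmorphM mulr_algl const_delw revK scalerA divff // scale1r rmorph1.
Qed.

(** * Regularity, by removing terms *)
Section Regularity.
Variables (P : {pred S}) (P_ring : subring_closed P) (E : {pred S}) (E_ring : subring_closed E).
Variable Rn : {pred ncser k}.
Hypothesis Rn_alg : subalg_closed Rn.
Hypothesis Rn_ser : {subset Rn <= series_in n}.
Hypothesis Rn_delta : forall i, (i <= n)%N -> {in Rn, forall f, delta i f \in Rn}.
Hypothesis Rn_unit : forall r, r \in Rn -> const_term r != 0 ->
  exists2 s, s \in Rn & r * s = 1.
Hypothesis P_of : forall r, r \in Rn -> ofser r \in P.
Hypothesis P_y : forall u, ymon u \in P.
Hypothesis P_x : forall i, skx i \in P.
Hypothesis E_x : forall i, (i <= n)%N -> skx i \in E.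
Hypothesis E_cf : forall a u, a \in E -> cf u a \in Rn /\ (cf u a != 0 -> inY u).

Let P1 : 1 \in P. Proof. by case: P_ring. Qed.
Let PM a b : a \in P -> b \in P -> a * b \in P. Proof. by case: P_ring => _ _; apply. Qed.
Let PB a b : a \in P -> b \in P -> a - b \in P. Proof. by case: P_ring => _ + _; apply. Qed.
Let P0 : 0 \in P. Proof. by rewrite -(subrr 1) PB. Qed.
Let PD a b : a \in P -> b \in P -> a + b \in P.
Proof. by move=> Pa Pb; rewrite -[b]opprK PB // -sub0r PB. Qed.

Let RZ x r s : r \in Rn -> s \in Rn -> x *: r + s \in Rn.
Proof. by case: Rn_alg => _ h _; apply: h. Qed.
Let R0 : 0 \in Rn.
Proof. by case: Rn_alg => R1 _ _; have := RZ (-1) R1 R1; rewrite scaleN1r addNr. Qed.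
Let RM r s : r \in Rn -> s \in Rn -> r * s \in Rn. Proof. by case: Rn_alg => _ _; apply. Qed.
Let RC x : x%:A \in Rn.
Proof. by case: Rn_alg => R1 _ _; have := RZ x R1 R0; rewrite addr0. Qed.
Let R_delw u r : inY u -> r \in Rn -> delw r u \in Rn.
Proof. by elim: u r => [//|i u IH] r /= /andP[i_n uY] rR; apply/IH/Rn_delta. Qed.

Let P_ske : ske \in P.
Proof.
apply: PB => //; apply: (big_ind (fun a => a \in P)) => // i _.
exact: PM.
Qed.

Let P_skX v : skX v \in P.
Proof. by elim: v => [|i v IH] //=; apply: PM. Qed.

Let ske_cyclic (Pe : ske \in subring_pred P_ring) : cyclic_class (Subring Pe).
Proof.
pose x i := Subring (P_x i : skx i \in subring_pred P_ring).
pose y i := Subring (P_y [:: i] : ymon [:: i] \in subring_pred P_ring).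
have -> : Subring Pe = 1 - \sum_(i < n.+1) y i * x i.
  by apply: val_inj; rewrite [RHS]raddfB [X in _ = _ - X]raddf_sum.
by apply: cyclic_class_cuntz => i j; apply: val_inj; rewrite /= skx_ymon; case: eqP.
Qed.

(** A nonzero coefficient l of r_v0 at a word w makes (e x_v0) c (y_(rev w) e l^-1)
    equal to e; the step with p = e subtracts a multiple of r_v0 from each r_v and
    makes the term at v0 vanish. *)
Lemma subring_cyclic_short (F : seq (seq nat)) (r : seq nat -> ncser k) :
    uniq F -> (forall v, v \in F -> inY v) -> (forall v, v \in F -> r v \in Rn) ->
  subring_cyclic P_ring (\sum_(v <- F) ymon v * (ske * ofser (r v))).
Proof.
have [m] := ubnP (size F); elim: m F r => // m IH F r Fm Funiq FY Fr.
have [[v0 v0F rv0]|r0] := pselect (exists2 v, v \in F & r v != 0); last first.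
  rewrite big_seq big1 => [|v vF]; first exact: subring_cyclic0.
  have [->|rv] := eqVneq (r v) 0; first by rewrite rmorph0 !mulr0.
  by case: r0; exists v.
have [_ [w [/predU1P[->|//] cw _]]] :=
  @min_order k _ [:: v0] r (ex_intro2 _ _ v0 (mem_head _ _) rv0).
have wY : inY (rev w).
  by rewrite all_rev; have /asboolP := Rn_ser (Fr _ v0F); apply.
set c := \sum_(v <- F) _; set l := coef (r v0) w in cw.
have Xc : ske * skX v0 * c = ske * ofser (r v0).
  rewrite /c mulr_sumr (bigD1_seq v0) //= big_seq_cond big1 ?addr0 => [|v].
    rewrite (mulrA (ymon _)) -(mulrA ske) (mulrA (skX _)) (mulrA ske).
    by rewrite ske_skX_ymon_ske ?FY // eqxx mulr1n.
  case/andP=> vF vv0; rewrite (mulrA (ymon _)) -(mulrA ske) (mulrA (skX _)) (mulrA ske).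
  by rewrite ske_skX_ymon_ske ?FY // eq_sym (negPf vv0) mulr0n mul0r.
have cY v : v \in F -> ske * ofser (r v) * (ymon (rev w) * ske) = ske * ofser (coef (r v) w)%:A.
  by move=> vF; rewrite ske_ser_ymon_ske ?revK // Rn_ser // Fr.
pose beta := ske * skX v0; pose gamma := ymon (rev w) * ske * ofser l^-1%:A.
have bcg : beta * c * gamma = ske.
  rewrite /beta /gamma Xc (mulrA (_ * _)) cY // -mulrA -rmorphM mulr_algl scalerA divff //.
  by rewrite scale1r rmorph1 mulr1.
apply: (@subring_cyclic_step _ _ P_ring _ beta gamma ske P_ske) => //.
- exact: PM.
- by apply: PM; [apply: PM|apply: P_of].
- exact: ske_idem.
- by rewrite /beta mulrA ske_idem.
pose r' v := r v - (coef (r v) w * l^-1) *: r v0.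
have -> : c - c * (gamma * beta) * c = \sum_(v <- F) ymon v * (ske * ofser (r' v)).
  rewrite -(mulrA c) -(mulrA gamma) [beta * c]Xc {1 2}/c mulr_suml -sumrB.
  apply: eq_big_seq => v vF; rewrite -(mulrA (ymon v)) -mulrBr; congr (_ * _).
  rewrite /gamma -(mulrA (ymon _ * ske)) (mulrA (ske * ofser _)) cY // ske_algM.
  by rewrite -mulrBr -rmorphB.
have r'v0 : r' v0 = 0 by rewrite /r' divff // scale1r subrr.
rewrite (big_rem v0) //= r'v0 rmorph0 !mulr0 add0r.
have sub v : v \in rem v0 F -> v \in F by apply: mem_rem.
apply: IH => [|||v /sub vF]; rewrite ?rem_uniq //.
- by rewrite size_rem // -ltnS prednK //; case: (F) v0F.
- by move=> v /sub /FY.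
by rewrite /r' addrC -scaleNr; apply: RZ; apply: Fr.
Qed.

(** The word w is a shortest one among all the r_v, so that r_v y_(rev w) is a
    series for every v in F, and a unit for v = v0.  The step with p = 1 then keeps
    the shape of the sum; words of the same length m are used for F in order that
    the dual of y_v0 kills the other terms, and G has shorter words only, which it
    kills because x_i e = 0. *)
Lemma subring_cyclic_reduced m (F G : seq (seq nat)) (r t : seq nat -> ncser k) :
  uniq F -> (forall v, v \in F -> [/\ size v = m, inY v & r v \in Rn]) ->
  uniq G -> (forall v, v \in G -> [/\ (size v < m)%N, inY v & t v \in Rn]) ->
  subring_cyclic P_ring (\sum_(v <- F) ymon v * ofser (r v) +
    \sum_(v <- G) ymon v * (ske * ofser (t v))).
Proof.
have [l] := ubnP (size F); elim: l F r t => // l IH F r t Fl Funiq FP Guniq GP.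
have [F0|r0] := pselect (exists2 v, v \in F & r v != 0); last first.
  rewrite big_seq big1 => [|v vF].
    by rewrite add0r; apply: subring_cyclic_short => // v /GP[].
  have [->|rv] := eqVneq (r v) 0; first by rewrite rmorph0 !mulr0.
  by case: r0; exists v.
have [v0 [w [v0F cw wmin]]] := min_order F0.
have [v0m v0Y rv0] := FP _ v0F.
have wY : inY (rev w) by rewrite all_rev; have /asboolP := Rn_ser rv0; apply.
have [|s Rs rs] := Rn_unit (R_delw wY rv0); first by rewrite const_delw revK.
set c := \sum_(v <- F) _; set d := \sum_(v <- G) _.
have Xc : skX v0 * (c + d) = ofser (r v0).
  rewrite mulrDr [X in _ + X]mulr_sumr [X in _ + X]big_seq [X in _ + X]big1 ?addr0 => [|v vG].
    rewrite mulr_sumr (bigD1_seq v0) //= big_seq_cond big1 ?addr0 => [|v].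
      by rewrite mulrA skX_ymon // eqxx mul1r.
    case/andP=> /FP[vm _ _] vv0; rewrite mulrA skX_ymon ?v0m ?vm //.
    by rewrite eq_sym (negPf vv0) mul0r.
  have [vm vY _] := GP _ vG.
  rewrite (mulrA (ymon v)) (mulrA (skX v0)) skX_ymon_ske ?v0m // 1?ltnW //.
  by case: eqP => [vv0|_]; [move: vm; rewrite -vv0 v0m ltnn|rewrite mulr0n mul0r].
pose gamma := ymon (rev w) * ofser s.
have rw v : v \in F -> ofser (r v) * ymon (rev w) = ofser (delw (r v) (rev w)).
  by move=> vF; apply: ofser_ymon => w'; rewrite size_rev; apply: wmin.
have bcg : skX v0 * (c + d) * gamma = 1.
  by rewrite Xc /gamma mulrA rw // -rmorphM rs rmorph1.
apply: (@subring_cyclic_step _ _ P_ring _ (skX v0) gamma 1 P1) => //.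
- have -> : Subring (P1 : 1 \in subring_pred P_ring) = 1 by apply: val_inj.
  by exists 1; rewrite mulr1z idem_class1.
- by apply: PM => //; apply: P_of.
- by rewrite mulr1.
- by rewrite mul1r.
pose r' v := r v - delw (r v) (rev w) * s * r v0.
pose t' v := t v - delw (t v) (rev w) * s * r v0.
have -> : c + d - (c + d) * (gamma * skX v0) * (c + d) =
    \sum_(v <- F) ymon v * ofser (r' v) + \sum_(v <- G) ymon v * (ske * ofser (t' v)).
  rewrite -(mulrA (c + d)) -(mulrA gamma) Xc mulrDl opprD addrACA.
  rewrite {1 2}/c {1 2}/d !mulr_suml -!sumrB; congr (_ + _); apply: eq_big_seq => v vFG.
    rewrite -(mulrA (ymon v)) -mulrBr; congr (_ * _).
    by rewrite /gamma -(mulrA (ymon _)) mulrA rw // mulrA -!rmorphM -rmorphB.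
  rewrite -(mulrA (ymon v)) -mulrBr; congr (_ * _).
  rewrite /gamma -(mulrA (ymon _)) -(mulrA ske) (mulrA (ofser _)) (mulrA ske) ske_ser_ymon //.
  by rewrite -(mulrA ske) -mulrBr mulrA -!rmorphM -rmorphB.
have Rr' (f : ncser k) : f \in Rn -> f - delw f (rev w) * s * r v0 \in Rn.
  move=> fR; rewrite addrC -scaleN1r; apply: RZ => //.
  by apply: RM => //; apply: RM => //; apply: R_delw.
have r'v0 : r' v0 = 0 by rewrite /r' rs mul1r subrr.
rewrite (big_rem v0) //= r'v0 rmorph0 !mulr0 add0r.
have sub v : v \in rem v0 F -> v \in F by apply: mem_rem.
apply: IH => [||v /sub /FP[vm vY rv]||v /GP[vm vY tv]]; rewrite ?rem_uniq //.
- by rewrite size_rem // -ltnS prednK //; case: (F) v0F.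
- by split=> //; apply: Rr'.
- by split=> //; apply: Rr'.
Qed.

Lemma subring_cyclic_ext a : a \in E -> subring_cyclic P_ring a.
Proof.
move=> Ea; pose m := (\max_(u <- supp a) size u)%N; pose r v := cf [::] (skX v * a).
have Er v : inY v -> r v \in Rn.
  move=> vY; have EXa : skX v * a \in E.
    have [_ _ EM] := E_ring; apply: EM => //; apply: skX_in.
      by split=> //; case: E_ring.
    by move=> i /(allP vY); apply: E_x.
  by have [] := E_cf [::] EXa.
have -> : a = \sum_(v <- words m) ymon v * ofser (r v) +
    \sum_(v <- short_words m) ymon v * (ske * ofser (r v)).
  rewrite -[a in LHS]mul1r (ymonX_partition m) mulrDl !mulr_suml.
  congr (_ + _); apply: eq_big_seq => v vW; rewrite -(mulrA (ymon v)); congr (_ * _).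
    have [f fE] : exists f, skX v * a = ofser f.
      have [vm _] := wordsP vW; rewrite (supp_sum a) mulr_sumr.
      rewrite big_seq; apply: (big_ind (fun b => exists f, b = ofser f)).
      - by exists 0; rewrite rmorph0.
      - by move=> _ _ [f ->] [g ->]; exists (f + g); rewrite rmorphD.
      move=> u ua; have [|f fE] := @skX_ymon_ser v u.
        by rewrite vm /m (big_rem u) //= leq_maxl.
      by exists (f * cf u a); rewrite mulrA fE rmorphM.
    by rewrite /r fE cf_ofser.
  rewrite -(mulrA ske) /r; have [_ vY] := short_wordsP vW.
  apply: mul_kill_ymon => [i|u]; first exact: ske_ymon.
  have EXa : skX v * a \in E.
    have [_ _ EM] := E_ring; apply: EM => //; apply: skX_in.
      by split=> //; case: E_ring.
    by move=> i /(allP vY); apply: E_x.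
  by have [] := E_cf u EXa.
apply: (@subring_cyclic_reduced m); rewrite ?words_uniq ?short_words_uniq //.
- by move=> v /wordsP[vm vY]; split=> //; apply: Er.
- by move=> v /short_wordsP[vm vY]; split=> //; apply: Er.
Qed.

End Regularity.

End SkewPresentation.

(** * The ring S_inf *)
Section SkewRing.
Variable k : fieldType.

Fact sk_of_nmod : nmod_morphism (@sk_of k).
Proof.
by split; [apply: (addrI (sk_of 0)); rewrite -sk_ofD !addr0|exact: sk_ofD].
Qed.

Fact sk_of_monoid : monoid_morphism (@sk_of k).
Proof. by split; [exact: sk_of1|exact: sk_ofM]. Qed.

HB.instance Definition _ := GRing.isNmodMorphism.Build _ _ (@sk_of k) sk_of_nmod.
HB.instance Definition _ := GRing.isMonoidMorphism.Build _ _ (@sk_of k) sk_of_monoid.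

Definition sk_ofL : {rmorphism ncser k -> skew k} := @sk_of k.
Definition sk_cf (u : seq nat) : {additive skew k -> ncser k} := @mcoeff _ _ u.
Definition sk_supp (a : skew k) : seq (seq nat) := enum_fset (msupp a).

Lemma sk_cf_y u r v : sk_cf v (sk_y k u * sk_of r) = r *+ (u == v).
Proof. by rewrite sk_yof; apply: mcoeffU. Qed.

Lemma sk_supp_cf a u : (u \in sk_supp a) = (sk_cf u a != 0).
Proof. by rewrite mcoeff_neq0. Qed.

End SkewRing.

Section Sinf.
Variables (k : fieldType) (R : nat -> {pred ncser k}).
Hypothesis R_alg : forall n, (1 <= n)%N -> subalg_closed (R n).
Hypothesis R_ser : forall n, (1 <= n)%N -> {subset R n <= series_in n}.
Hypothesis R_poly : forall n, (1 <= n)%N -> {subset freealg_in n <= R n}.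
Hypothesis R_local : forall n (n_ge1 : (1 <= n)%N),
  local_ring (subring (GRing.subalg_closedBM (R_alg n_ge1))).
Hypothesis R_delta : forall n i, (1 <= n)%N -> (i <= n)%N ->
  {in R n, forall f, delta i f \in R n}.
Hypothesis R_incr : forall n, (1 <= n)%N -> {subset R n <= R n.+1}.

Let Sinf_ring := Sinf_subring R_alg R_delta R_incr.
Let Sinf : nzRingType := subring Sinf_ring.
Let X i : skew k := skx (sk_ofL k) i.

Let R_const n x : (1 <= n)%N -> x%:A \in R n.
Proof.
move=> n1; have [R1 RZ _] := R_alg n1.
have R0 : 0 \in R n by have := RZ (-1) 1 1 R1 R1; rewrite scaleN1r addNr.
by have := RZ x 1 0 R1 R0; rewrite addr0.
Qed.

Let ext_of n r u : (1 <= n)%N -> r \in R n -> all (fun i => (i <= n)%N) u ->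
  sk_y k u * sk_of r \in skewext n (R n).
Proof.
move=> n1 Rr Yu; rewrite sk_yof; apply/asboolP => v; rewrite mcoeffU mulrb.
case: eqVneq => [<-|_]; first by split.
by rewrite eqxx; split=> //; have := R_const 0 n1; rewrite scale0r.
Qed.

Let sub n a : (1 <= n)%N -> a \in skewext n (R n) -> a \in Sinf_pred R.
Proof. by move=> n1 an; apply/asboolP; exists n. Qed.

Let R_x n i : (1 <= n)%N -> (i <= n)%N -> xser k i \in R n.
Proof.
move=> n1 i_n; apply: R_poly => //; apply/andP; split.
  by apply/asboolP => w /=; case: (w =P [:: i]) => [->|]; rewrite ?eqxx //= i_n.
by apply/asboolP; exists [:: [:: i]] => w /=; case: (w =P [:: i]) => [->|]; rewrite ?eqxx ?inE.
Qed.

Let ext_x n i : (1 <= n)%N -> (i <= n)%N -> X i \in skewext n (R n).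
Proof.
by move=> n1 i_n; rewrite -[X i]mul1r -sk_y0; apply: ext_of => //; apply: R_x.
Qed.

Let P_x i : X i \in Sinf_pred R.
Proof. by apply: (@sub i.+1) => //; apply: ext_x => //; apply: leqnSn. Qed.

Let P_of n r : (1 <= n)%N -> r \in R n -> sk_of r \in Sinf_pred R.
Proof.
move=> n1 Rr; apply: (@sub n) => //.
by rewrite -[sk_of r]mul1r -sk_y0; apply: ext_of.
Qed.

Let P_X v : skX (sk_ofL k) v \in Sinf_pred R.
Proof.
have [P1 _ PM] := Sinf_ring.
by elim: v => [|i v IH]; [exact: P1|exact: (PM _ _ IH (P_x i))].
Qed.

Let P_y u : sk_y k u \in Sinf_pred R.
Proof.
apply: (@sub (\max_(i <- u) i).+1) => //; rewrite -[sk_y k u]mulr1 -sk_of1.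
apply: ext_of => //; first by rewrite -(scale1r 1) R_const.
by apply/allP => i iu; rewrite (big_rem i) //= leqW // leq_maxl.
Qed.

Let skew_xy i j : X i * sk_y k [:: j] = (i == j)%:R.
Proof. exact: (skx_ymon (@sk_of_y k)). Qed.

Let x i : Sinf := Subring (P_x i : X i \in subring_pred Sinf_ring).
Let y i : Sinf := Subring (P_y [:: i] : sk_y k [:: i] \in subring_pred Sinf_ring).

Let xy i j : x i * y j = (i == j)%:R.
Proof. by apply: val_inj; rewrite /= skew_xy; case: eqP. Qed.

Let Sinf_two_sided_inverses (a : Sinf) : a != 0 -> exists s t, s * a * t = 1.
Proof.
move=> a0; have /asboolP[n n1 /asboolP an] := subring_valP a.
have a0' : subring_val a != 0 by apply: contra_neq a0 => a0; apply: val_inj.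
have [v [u [c vY sat]]] := skew_two_sided_inverses (ofser := sk_ofL k) (@sk_y0 k) (@sk_yM k)
  (@sk_of_y k) (@sk_cf_y k) (@sk_supp_cf k) (@sk_basis k) a0'
  (fun u => proj2 (an u)) (fun u => R_ser n1 (proj1 (an u))).
have [P1 _ PM] := Sinf_ring.
have Ps : X n.+1 * skX (sk_ofL k) v \in subring_pred Sinf_ring := PM _ _ (P_x _) (P_X v).
have Pt : sk_y k u * sk_y k [:: n.+1] * sk_of c%:A \in subring_pred Sinf_ring :=
  PM _ _ (PM _ _ (P_y u) (P_y _)) (P_of n1 (R_const c n1)).
by exists (Subring Ps), (Subring Pt); apply: val_inj.
Qed.

Let Sinf_cyclic_regular (a : Sinf) : cyclic_regular a.
Proof.
have /asboolP[n n1 an] := subring_valP a.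
suff: subring_cyclic Sinf_ring (subring_val a).
  by move/(_ (subring_valP a)); case: (a).
have E_ring : subring_closed (skewext n (R n)).
  by apply: skewext_subring; [exact: R_alg|move=> i; apply: R_delta].
apply: (subring_cyclic_ext (ofser := sk_ofL k) (@sk_y0 k) (@sk_yM k) (@sk_of_y k) (@sk_cf_y k)
  (@sk_supp_cf k) (@sk_basis k) E_ring (R_alg n1) (R_ser n1)
  (fun i => R_delta n1) _ (fun r => P_of n1) P_y P_x (fun i => ext_x n1) _ an).
- by move=> r; apply: local_series_right_unit (R_local n1).
- by move=> b u /asboolP/(_ u).
Qed.

Let Sinf_cuntz n (xi eta : 'I_n.+1 -> Sinf) :
  (forall i j, xi i * eta j = (i == j)%:R) -> \sum_i eta i * xi i = 1 -> n = 0%N.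
Proof.
move=> xieta etaxi.
have := @skew_cuntz_rank1 k (skew k) (sk_ofL k) _ _ _ (@sk_y0 k) (@sk_yM k) (@sk_of_y k)
  (@sk_cf_y k) (@sk_basis k) n (fun i => subring_val (xi i)) (fun i => subring_val (eta i)).
apply.
- by move=> i j; rewrite -[LHS]/(subring_val (xi i * eta j)) xieta; case: eqP.
- transitivity (subring_val (1 : Sinf)) => //; rewrite -etaxi -[RHS]/(val _) raddf_sum.
  by apply: eq_bigr.
Qed.

Lemma Sinf_properties : [/\ simple_ring Sinf, vn_regular Sinf, purely_infinite Sinf
  & infinite_cyclic_with_generator (K0_unit Sinf)].
Proof.
split; first exact: simple_of_two_sided_inverses Sinf_two_sided_inverses.
- by move=> a; have [b [aba _]] := Sinf_cyclic_regular a; exists b.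
- apply: (purely_infinite_of_two_sided_inverses Sinf_two_sided_inverses (xy 0 0)).
  apply/eqP => yx; have y1 : y 1 = 0 by rewrite -[LHS]mul1r -yx -mulrA xy mulr0.
  by have /esym/eqP := xy 1 1; rewrite y1 mulr0 oner_eq0.
- split; first exact: (K0_cyclic xy Sinf_cyclic_regular).
  by apply: (K0_unit_order xy) => n xi eta; apply: Sinf_cuntz.
Qed.

End Sinf.

Theorem proposition5p8 (k : fieldType) (R : nat -> {pred ncser k})
    (R_alg : forall n, (1 <= n)%N -> subalg_closed (R n))
    (R_ser : forall n, (1 <= n)%N -> {subset R n <= series_in n})
    (R_poly : forall n, (1 <= n)%N -> {subset freealg_in n <= R n})
    (R_local : forall n (n_ge1 : (1 <= n)%N),
       local_ring (subring (GRing.subalg_closedBM (R_alg n n_ge1))))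
    (R_delta : forall n i, (1 <= n)%N -> (i <= n)%N ->
       {in R n, forall f, delta i f \in R n})
    (R_incr : forall n, (1 <= n)%N -> {subset R n <= R n.+1}) :
  let S_inf : nzRingType := subring (Sinf_subring R_alg R_delta R_incr) in
  [/\ simple_ring S_inf,
      vn_regular S_inf,
      purely_infinite S_inf
    & infinite_cyclic_with_generator (K0_unit S_inf)].
Proof. exact: Sinf_properties. Qed.
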